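(* Let $Q$ be a smooth $n$-dimensional manifold, let $\mathcal C\subset TQ$ be the constraint submanifold for a system of nonholonomic linear constraints, $\mathcal D$ the corresponding constraint distribution (of rank $m$), and $L$ a Lagrangian on $TQ$ which is regular with respect to $\mathcal D$. Then there is a unique vector field $\Gamma$ on $\mathcal C$ which is of second-order type, is tangent to $\mathcal C$, and is such that on $\mathcal C$ $$\Gamma(Z^{\mathrm V}(L))-Z^{\mathrm C}(L)=0$$ for all vector fields $Z$ on $Q$ taking values in $\mathcal D$. Moreover, $\Gamma$ may be determined from the equations $$\Gamma(X_\alpha^{\mathrm V}(L))-X_\alpha^{\mathrm C}(L)=0,\qquad \alpha=1,2,\ldots,m,$$ on $\mathcal C$, where $\{X_\alpha\}$ is any local basis of vector fields for $\mathcal D$; that is, over the domain of the basis, $\Gamma$ is the unique vector field on $\mathcal C$, of second-order type and tangent to $\mathcal C$, satisfying these equations.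
   Context: $\tau:TQ\to Q$ is the tangent bundle projection; $q^i$ are local coordinates on $Q$ and $u^i$ the corresponding fibre coordinates on $TQ$; summation convention. For a vector field $Z=Z^i\,\partial/\partial q^i$ on $Q$, the complete lift is $Z^{\mathrm C}=Z^i\frac{\partial}{\partial q^i}+u^j\frac{\partial Z^i}{\partial q^j}\frac{\partial}{\partial u^i}$ and the vertical lift is $Z^{\mathrm V}=Z^i\frac{\partial}{\partial u^i}$, both vector fields on $TQ$. A system of nonholonomic linear constraints is a smooth distribution $\mathcal D$ on $Q$ of constant rank $m$ which is not integrable in the sense of Frobenius; the constraint submanifold $\mathcal C\subset TQ$ is the corresponding subbundle, $\mathcal C=\{(q,u): u\in\mathcal D_q\}$. A ''vector field on $\mathcal C$'' means a smooth assignment, to each point of $\mathcal C$, of a tangent vector to $TQ$ at that point; it may be tangent to $\mathcal C$ or not. It acts on functions on $TQ$ to give functions on $\mathcal C$. It is of second-order type if $\tau_{*(q,u)}\Gamma=u$ for all $(q,u)\in\mathcal C$. $L$ (a smooth function on $TQ$) is regular with respect to $\mathcal D$ if for any local basis $\{X_\alpha\}$ of $\mathcal D$ the symmetric $m\times m$ matrix of functions $X_\alpha^{\mathrm V}(X_\beta^{\mathrm V}(L))$ is nonsingular at all points of $\mathcal C$. *)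

(* Defs.v *)
(* Developed over MathComp and MathComp-Analysis, with R : realType as the
   field of real numbers. *)
From HB Require Import structures.
From mathcomp Require Import all_boot all_order all_algebra.
From mathcomp Require Import all_classical all_reals all_analysis.

Set Implicit Arguments.
Unset Strict Implicit.
Unset Printing Implicit Defensive.

Import Order.TTheory GRing.Theory Num.Theory.
Import numFieldNormedType.Exports.

Local Open Scope classical_set_scope.
Local Open Scope ring_scope.

Section Smooth.
Context {R : realType} {V W : normedModType R}.

(* For finite-dimensional V (the only case used below) asking for all
   directional derivatives amounts to asking for all partial derivatives. *)
Fixpoint Ck (k : nat) (U : set V) (f : V -> W) : Prop :=
  match k with
  | 0 => forall x, U x -> {for x, continuous f}
  | k'.+1 => (forall x, U x -> differentiable f x) /\
             forall v, Ck k' U (fun x => 'D_v f x)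
  end.

(* S need not be open: f is smooth on S when it extends, locally around each
   point of S, to a smooth function on an open subset of V.  The values of f
   outside S are irrelevant. *)
Definition smooth_on (S : set V) (f : V -> W) : Prop :=
  forall x, S x -> exists U : set V, exists g : V -> W,
    [/\ open U, U x, (forall k, Ck k U g) & {in S `&` U, f =1 g}].

End Smooth.

(* [cmap] is meaningful on [cdom], and [cinv], inverse to it, is meaningful on
   the image of [cdom]; other values are irrelevant. *)
Record chart (R : realType) (n : nat) (M : Type) := Chart {
  cdom : set M;
  cmap : M -> 'rV[R]_n;
  cinv : 'rV[R]_n -> M }.

(* [chart_at] selects, around each point, a preferred chart of the atlas.  It
   is not required to depend on the point in any regular way. *)
Record atlas (R : realType) (n : nat) (M : Type) := Atlas {
  charts : set (chart R n M);
  chart_at : M -> chart R n M }.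

Definition compatible {R : realType} {n : nat} {M : Type}
    (c c' : chart R n M) : Prop :=
  smooth_on (cmap c @` (cdom c `&` cdom c')) (cmap c' \o cinv c).

Record homeo_chart {R : realType} {n : nat} {M : topologicalType}
    (c : chart R n M) : Prop := {
  homeo_chart_dom : open (cdom c);
  homeo_chart_img : open (cmap c @` cdom c);
  homeo_chartK : {in cdom c, cancel (cmap c) (cinv c)};
  homeo_chart_cont : {in cdom c, continuous (cmap c)};
  homeo_chart_inv_cont : {in cmap c @` cdom c, continuous (cinv c)} }.

Record smooth_manifold {R : realType} {n : nat} {M : topologicalType}
    (A : atlas R n M) : Prop := {
  manifold_hausdorff : hausdorff_space M;
  manifold_second_countable : @second_countable M;
  manifold_chart_at : forall p, charts A (chart_at A p) /\ cdom (chart_at A p) p;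
  manifold_charts : forall c, charts A c -> homeo_chart c;
  manifold_compatible : forall c c', charts A c -> charts A c' -> compatible c c' }.

Section Tangent.
Context {R : realType} {n : nat} {M : Type} (A : atlas R n M).

(* A tangent vector at p is represented by its components in the preferred
   chart at p, so that T_p M is 'rV[R]_n and TM is M * 'rV[R]_n (as a set; its
   charts are defined below).  [components c p v] are the components in the
   chart c of the tangent vector v at p, obtained from the preferred ones
   through the Jacobian matrix of the change of coordinates. *)
Definition components (c : chart R n M) (p : M) (v : 'rV[R]_n) : 'rV[R]_n :=
  'D_v (cmap c \o cinv (chart_at A p)) (cmap (chart_at A p) p).

Definition vaction (p : M) (v : 'rV[R]_n) (f : M -> R) : R :=
  'D_v (f \o cinv (chart_at A p) : _ -> R) (cmap (chart_at A p) p).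

Definition smooth_fun (f : M -> R) : Prop :=
  forall c, charts A c -> smooth_on (cmap c @` cdom c) (f \o cinv c).

(* The vector field Z as a function of the coordinates in the chart c. *)
Definition local_field (c : chart R n M) (Z : M -> 'rV[R]_n) :
    'rV[R]_n -> 'rV[R]_n :=
  fun x => components c (cinv c x) (Z (cinv c x)).

(* Smoothness of a field of tangent vectors to M along a subset S of M; for S
   open this is smoothness of a vector field on S. *)
Definition smooth_vfield (S : set M) (Z : M -> 'rV[R]_n) : Prop :=
  forall c, charts A c -> smooth_on (cmap c @` (cdom c `&` S)) (local_field c Z).

(* v is tangent at p to the subset C: it is the velocity at time 0 of a smooth
   curve lying in C.  The curve is only considered for |t| < e, where it stays
   in the domain of the preferred chart at p. *)
Definition tangent_to (C : set M) (p : M) (v : 'rV[R]_n) : Prop :=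
  exists (e : R) (g : R -> M), let c := chart_at A p in
  [/\ 0 < e, g 0 = p,
      (forall t, `|t| < e -> C (g t) /\ cdom c (g t)),
      smooth_on [set t : R | `|t| < e] (cmap c \o g)
    & 'D_1 (cmap c \o g) 0 = v].

(* The chart (q^i, u^i) of TM induced by a chart (q^i) of M. *)
Definition tangent_chart (c : chart R n M) :
    chart R (n + n) (M * 'rV[R]_n) :=
  {| cdom := [set p | cdom c p.1];
     cmap := fun p => row_mx (cmap c p.1) (components c p.1 p.2);
     cinv := fun z =>
       let x := lsubmx z in let q := cinv c x in
       (q, 'D_(rsubmx z) (cmap (chart_at A q) \o cinv c) x) |}.

Definition tangent_atlas : atlas R (n + n) (M * 'rV[R]_n) :=
  {| charts := tangent_chart @` charts A;
     chart_at := fun p => tangent_chart (chart_at A p.1) |}.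

(* The lifts of Z at p = (q, u), in the coordinates (q^i, u^i) induced by the
   preferred chart at q. *)
Definition vlift (Z : M -> 'rV[R]_n) : M * 'rV[R]_n -> 'rV[R]_(n + n) :=
  fun p => row_mx 0 (Z p.1).

Definition clift (Z : M -> 'rV[R]_n) : M * 'rV[R]_n -> 'rV[R]_(n + n) :=
  fun p => let c := chart_at A p.1 in
  row_mx (Z p.1) ('D_(p.2) (local_field c Z) (cmap c p.1)).

End Tangent.

Definition dmap {R : realType} {n k : nat} {M N : Type}
    (A : atlas R n M) (B : atlas R k N) (F : M -> N) (p : M)
    (v : 'rV[R]_n) : 'rV[R]_k :=
  'D_v (cmap (chart_at B (F p)) \o F \o cinv (chart_at A p))
       (cmap (chart_at A p) p).

Section Distribution.
Context {R : realType} {n m : nat} {Q : topologicalType}.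
Context (A : atlas R n Q) (D : Q -> {vspace 'rV[R]_n}).

Record local_basis (U : set Q) (X : 'I_m -> Q -> 'rV[R]_n) : Prop := {
  local_basis_open : open U;
  local_basis_smooth : forall a, smooth_vfield A U (X a);
  local_basisP : forall q, U q -> basis_of (D q) [tuple X a q | a < m] }.

(* Around each point there is a flat chart, in which D is spanned by the first
   m coordinate fields. *)
Definition frobenius_integrable : Prop :=
  forall q, exists c : chart R n Q,
    [/\ homeo_chart c, cdom c q,
        (forall c', charts A c' -> compatible c c' /\ compatible c' c)
      & forall q', cdom c q' -> forall u,
          u \in D q' <->
          (forall j : 'I_n, (m <= j)%N -> components A c q' u 0 j = 0)].

Record nonholonomic : Prop := {
  nonholonomic_rank : forall q, \dim (D q) = m;
  nonholonomic_smooth : forall q, exists U X, U q /\ local_basis U X;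
  nonholonomic_nonintegrable : ~ frobenius_integrable }.

Definition constraint : set (Q * 'rV[R]_n) := [set p | p.2 \in D p.1].

Definition constraint_over (U : set Q) : set (Q * 'rV[R]_n) :=
  [set p | U p.1 /\ constraint p].

Definition regular_lagrangian (L : Q * 'rV[R]_n -> R) : Prop :=
  forall U X, local_basis U X -> forall p, constraint_over U p ->
    let TA := tangent_atlas A in
    \matrix_(a < m, b < m)
      vaction TA p (vlift (X a) p)
        (fun p' => vaction TA p' (vlift (X b) p') L) \in unitmx.

(* Fields of tangent vectors to TQ along the part of the constraint submanifold
   lying over U; the values of G elsewhere are irrelevant. *)
Record constrained_sode (U : set Q) (G : Q * 'rV[R]_n -> 'rV[R]_(n + n)) :
    Prop := {
  sode_smooth : smooth_vfield (tangent_atlas A) (constraint_over U) G;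
  sode_second_order : forall p, constraint_over U p ->
    dmap (tangent_atlas A) A fst p (G p) = p.2;
  sode_tangent : forall p, constraint_over U p ->
    tangent_to (tangent_atlas A) constraint p (G p) }.

Definition lagrange_eq (L : Q * 'rV[R]_n -> R)
    (G : Q * 'rV[R]_n -> 'rV[R]_(n + n)) (Z : Q -> 'rV[R]_n)
    (p : Q * 'rV[R]_n) : Prop :=
  let TA := tangent_atlas A in
  vaction TA p (G p) (fun p' => vaction TA p' (vlift Z p') L)
  - vaction TA p (clift A Z p) L = 0.

End Distribution.

(* Main.v *)
(** Fix a point of C and a chart. Writing Z = Z^i d/dq^i and using that Gamma is
    of second-order type, the terms of Gamma(Z^V L) and Z^C(L) that contain
    derivatives of Z cancel, so the equation only depends on the value of Z at
    the point and is linear in it; it is therefore enough to impose it for a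
    local basis X_1, ..., X_m. If B is the matrix whose rows are the X_a, then
    (q, u) lies in C iff u = y B(q) for a (unique) row y, and a second-order
    Gamma = (u, g) is tangent to C iff g = y D_u B + f B for some row f. The
    equations for the X_a then become a linear system for f whose matrix is the
    regularity matrix X_a^V(X_b^V(L)), which gives existence, uniqueness and a
    smooth formula for g in every chart. That the formulas in two charts agree
    is the invariance of the complete lift, i.e. the symmetry of second
    derivatives. Uniqueness among fields satisfying the equation for global Z
    only requires extending the value of a local section to a global one, by a
    bump function. *)
Require Import Defs.
From HB Require Import structures.
From mathcomp Require Import all_boot all_order all_algebra.
From mathcomp Require Import all_classical all_reals all_analysis.
From mathcomp Require Import ring.
Set Implicit Arguments.
Unset Strict Implicit.
Unset Printing Implicit Defensive.
Import Order.TTheory GRing.Theory Num.Theory.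
Import numFieldNormedType.Exports.
Local Open Scope classical_set_scope.
Local Open Scope ring_scope.

(** * Derivatives and functions of class C^k *)

Section Differentiation.
Context {R : realType}.
Implicit Types V W E : normedModType R.

(** A vector at [p] is stored by its components in [chart_at A p], a chart that may jump with [p].
    Stored components therefore cannot be differentiated directly: each statement is first moved to
    a fixed chart [c] by [components], and a preferred chart serves only at one point at a time. The
    second obstacle is that the constraint set is not open, so that smoothness along it means having
    smooth local extensions in coordinates. The basis matrix is rectangular and y has no meaning off
    the constraint set; multiplying by a fixed matrix [N], a right inverse of the basis matrix at
    one point, gives a square matrix that stays invertible nearby and a formula for y that makes
    sense off the constraint set. Likewise the regularity matrix is known to be invertible only on
    the constraint set, but invertibility is an open condition. The field is chosen point by point,
    with an arbitrary local basis at each point. *)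

Lemma near_zero_differentiable V W (h : V -> W) (x : V) :
  (\forall y \near x, h y = 0) -> differentiable h x.
Proof.
move=> h0.
have hx : h x = 0 := nbhs_singleton h0.
(* An expansion with zero linear part determines the differential: [diff_unique] makes it 0, and
   with this value the expansion is the very condition for differentiability. *)
have key : h \o shift x = cst (h x) + 0 +o_ 0 id.
  apply/eqaddoP => _/posnumP[e].
  have : \forall y \near (0 : V), h (y + x) = 0.
    have : (fun y : V => y + x) @ (0 : V) --> x.
      rewrite -[X in _ --> X]add0r; apply: cvgD; [exact: cvg_id|exact: cvg_cst].
    by move=> /(_ _ h0).
  apply: filterS => y hy.
  by rewrite !fctE /= hy hx addr0 subr0 normr0 mulr_ge0.
have d0 : 'd h x = 0 :> (V -> W).
  by apply/diff_unique; [have [] := dcst (0 : W) x|exact: key].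
apply/diff_locallyP; rewrite d0; split; last exact: key.
by have [] := dcst (0 : W) x.
Qed.

(** The difference [g - f] vanishes near [x], so adding it to [f] costs nothing. This locality
    allows chart formulas to be exchanged when they agree only near a point. *)
Lemma near_eq_differentiable V W (f g : V -> W) (x : V) :
  (\forall y \near x, f y = g y) -> differentiable f x -> differentiable g x.
Proof.
move=> fg df.
have -> : g = f + (g - f) by apply/funext => y; rewrite !fctE addrC subrK.
apply: differentiableD => //; apply: near_zero_differentiable.
by apply: filterS fg => y; rewrite !fctE => ->; rewrite subrr.
Qed.

Lemma derive_comp V E W (f : V -> E) (g : E -> W) x v :
  differentiable f x -> differentiable g (f x) ->
  'D_v (g \o f) x = 'D_('D_v f x) g (f x).
Proof.
move=> df dg; rewrite (deriveE _ (differentiable_comp df dg)) (deriveE _ dg) (deriveE _ df).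
by rewrite diff_comp.
Qed.

Lemma deriveDdir V W (f : V -> W) x u v :
  differentiable f x -> 'D_(u + v) f x = 'D_u f x + 'D_v f x.
Proof. by move=> df; rewrite !(deriveE _ df) linearD. Qed.

Lemma deriveZdir V W (f : V -> W) x a v :
  differentiable f x -> 'D_(a *: v) f x = a *: 'D_v f x.
Proof. by move=> df; rewrite !(deriveE _ df) linearZ. Qed.

Lemma derive_sumdir V W (f : V -> W) x I (r : seq I) (P : pred I) (F : I -> V) :
  differentiable f x ->
  'D_(\sum_(i <- r | P i) F i) f x = \sum_(i <- r | P i) 'D_(F i) f x.
Proof.
by move=> df; rewrite (deriveE _ df) linear_sum; apply: eq_bigr => i _; rewrite (deriveE _ df).
Qed.

(** Scaling is a continuous bilinear map on [R^o * W]; the product rule is the chain rule through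
    it. *)
Lemma derive_scale V W (a : V -> R) (f : V -> W) x v :
  differentiable a x -> differentiable f x ->
  differentiable (fun y => a y *: f y) x /\
  'D_v (fun y => a y *: f y) x = a x *: 'D_v f x + 'D_v a x *: f x.
Proof.
move=> da df.
have bil : bilinear_for
    (GRing.Scale.Law.clone _ _ ( *:%R : R -> W -> W) _)
    (GRing.Scale.Law.clone _ _ ( *:%R : R -> W -> W) _)
    (fun (c : R^o) (w : W) => c *: w).
  split=> [w c b d|c b u w] /=; first by rewrite scalerDl scalerA.
  by rewrite scalerDr !scalerA mulrC.
pose bM := bilinear_isBilinear.Build _ _ _ _ _ _ _ bil.
pose b : {bilinear R^o -> W -> W} := HB.pack (fun (c : R^o) (w : W) => c *: w) bM.
have bc : continuous (fun p : R^o * W => b p.1 p.2) by exact: scale_continuous.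
have dp := differentiable_pair da df.
have db := differentiable_bilin (a x, f x) bc.
have dba : differentiable (fun y => a y *: f y) x by exact: (differentiable_comp dp db).
split => //; rewrite (deriveE _ dba) (deriveE _ da) (deriveE _ df).
have dc : 'd (fun y => a y *: f y) x v
    = 'd (fun p : R^o * W => b p.1 p.2) (a x, f x) ('d (fun y => (a y, f y) : R^o * W) x v).
  exact: (congr1 (fun h : V -> W => h v) (diff_comp dp db)).
by rewrite dc (diff_bilin _ bc) (diff_pair da df).
Qed.

Lemma derive_clin V E W (l : {linear E -> W}) (f : V -> E) x v :
  continuous l -> differentiable f x ->
  differentiable (fun y => l (f y)) x /\ 'D_v (fun y => l (f y)) x = l ('D_v f x).
Proof.
move=> cl df; have dl := linear_differentiable (f x) cl; split.
  exact: (differentiable_comp df dl).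
by rewrite (derive_comp _ df dl) (deriveE _ dl) diff_lin.
Qed.

Lemma derive_cst_fun V W (w : W) (x v : V) : 'D_v (fun=> w) x = 0.
Proof. exact: (@derive_cst _ V W w x v). Qed.

End Differentiation.

Section Smoothness.
Context {R : realType}.
Implicit Types V W E : normedModType R.

Lemma CkW k V W (U : set V) (f : V -> W) : Ck k.+1 U f -> Ck k U f.
Proof.
elim: k f => [f [df _] x Ux|k IH f [df Df]].
  exact/differentiable_continuous/df.
by split=> // v; exact/IH/Df.
Qed.

Lemma Ck_sub k V W (U U' : set V) (f : V -> W) : U' `<=` U -> Ck k U f -> Ck k U' f.
Proof.
move=> sU; elim: k f => [f h x /sU|k IH f [df Df]]; first exact: h.
by split=> [x /sU /df//|v]; exact/IH/Df.
Qed.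

Lemma Ck_eq k V W (U : set V) (f g : V -> W) :
  open U -> {in U, f =1 g} -> Ck k U f -> Ck k U g.
Proof.
move=> oU; elim: k f g => [|k IH] f g fg.
  move=> cf x Ux; have nfg : \forall y \near x, f y = g y.
    by apply: filterS (open_nbhs_nbhs (conj oU Ux)) => y Uy; exact/fg/mem_set.
  rewrite /prop_for /continuous_at -(nbhs_singleton nfg).
  exact: cvg_trans (near_eq_cvg nfg) (cf _ Ux).
have nfg x : U x -> \forall y \near x, f y = g y.
  by move=> Ux; apply: filterS (open_nbhs_nbhs (conj oU Ux)) => y Uy; exact/fg/mem_set.
move=> [df Df]; split=> [x Ux|v].
  exact: near_eq_differentiable (nfg x Ux) (df x Ux).
apply: IH (Df v) => x /set_mem Ux; exact/near_eq_derive/nfg.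
Qed.

Lemma Ck_local k V W (U : set V) (f : V -> W) :
  (forall x, U x -> exists U', [/\ open U', U' x & Ck k U' f]) -> Ck k U f.
Proof.
elim: k f => [|k IH] f h.
  by move=> x /h[U' [_ U'x cf]]; exact: cf.
split=> [x /h[U' [_ U'x [df _]]]|v]; first exact: df.
by apply: IH => x /h[U' [oU' U'x [_ Df]]]; exists U'; split=> //; exact: Df.
Qed.

Lemma Ck_cst k V W (U : set V) (w : W) : Ck k U (fun=> w).
Proof.
elim: k w => [w x _|k IH w]; first exact: cvg_cst.
split=> [x _|v]; first exact: differentiable_cst.
by under eq_fun do rewrite derive_cst_fun; exact: IH.
Qed.

Lemma Ck_add k V W (U : set V) (f g : V -> W) : open U ->
  Ck k U f -> Ck k U g -> Ck k U (fun x => f x + g x).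
Proof.
move=> oU; elim: k f g => [|k IH] f g.
  by move=> cf cg x Ux; apply: cvgD; [exact: cf|exact: cg].
move=> [df Df] [dg Dg]; split=> [x Ux|v].
  by apply: differentiableD; [exact: df|exact: dg].
apply: Ck_eq (IH _ _ (Df v) (Dg v)) => // x /set_mem Ux.
by rewrite -deriveD //; apply: diff_derivable; [exact: df|exact: dg].
Qed.

Lemma Ck_scale k V W (U : set V) (a : V -> R) (f : V -> W) : open U ->
  Ck k U a -> Ck k U f -> Ck k U (fun x => a x *: f x).
Proof.
move=> oU; elim: k a f => [|k IH] a f.
  by move=> ca cf x Ux; apply: cvgZ; [exact: ca|exact: cf].
(* The product rule keeps one factor undifferentiated, so the induction hypothesis also needs both
   functions at order [k]. *)
move=> ha hf; have ha' := CkW ha; have hf' := CkW hf.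
case: ha hf => da Da [df Df]; split=> [x Ux|v].
  exact: (derive_scale 0 (da x Ux) (df x Ux)).1.
apply: Ck_eq (Ck_add oU (IH _ _ ha' (Df v)) (IH _ _ (Da v) hf')) => // x /set_mem Ux.
by rewrite (derive_scale v (da x Ux) (df x Ux)).2.
Qed.

Lemma Ck_sum k V W (U : set V) I (r : seq I) (P : pred I) (F : I -> V -> W) :
  open U -> (forall i, P i -> Ck k U (F i)) ->
  Ck k U (fun x => \sum_(i <- r | P i) F i x).
Proof.
move=> oU h; elim: r => [|i r IH].
  by under eq_fun do rewrite big_nil; exact: Ck_cst.
under eq_fun do rewrite big_cons.
case: (boolP (P i)) => [Pi|_]; last exact: IH.
by apply: Ck_add => //; exact: h.
Qed.

Lemma Ck_clin k V W E (l : {linear E -> W}) (U : set V) (f : V -> E) : open U ->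
  continuous l -> Ck k U f -> Ck k U (fun x => l (f x)).
Proof.
move=> oU cl; elim: k f => [|k IH] f.
  by move=> cf x Ux; apply: continuous_comp; [exact: cf|exact: cl].
move=> [df Df]; split=> [x Ux|v].
  exact: (derive_clin 0 cl (df x Ux)).1.
by apply: Ck_eq (IH _ (Df v)) => // x /set_mem Ux; rewrite (derive_clin v cl (df x Ux)).2.
Qed.

Lemma Ck_lin k V W (l : {linear V -> W}) (U : set V) : open U ->
  continuous l -> Ck k U l.
Proof.
move=> oU cl; apply: (@Ck_clin k V W V l U id) => //.
case: k => [x _|k]; first exact: cvg_id.
split=> [x _|v].
  by have [] := is_diff_id x.
by apply: Ck_eq (Ck_cst k U v) => // x _; rewrite derive_id.
Qed.

(* A finite frame [e], [l] of [E] turns the chain rule into a finite sum of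
   products, so that induction on [k] applies. *)
Lemma Ck_comp k V W E N (e : 'I_N -> E) (l : 'I_N -> {linear E -> R})
    (U : set V) (U' : set E) (f : V -> E) (g : E -> W) :
  (forall i, continuous (l i)) -> (forall v, v = \sum_i l i v *: e i) ->
  open U -> open U' -> (forall x, U x -> U' (f x)) ->
  Ck k U f -> Ck k U' g -> Ck k U (fun x => g (f x)).
Proof.
move=> cl le oU oU' fU; elim: k g => [|k IH] g.
  by move=> cf cg x Ux; apply: continuous_comp; [exact: cf|exact/cg/fU].
move=> hf [dg Dg]; have hf' := CkW hf; case: hf => df Df; split=> [x Ux|v].
  by apply: differentiable_comp; [exact: df|exact/dg/fU].
apply: (@Ck_eq _ _ _ _
  (fun x => \sum_i l i ('D_v f x) *: 'D_(e i) g (f x))) => //.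
  move=> x /set_mem Ux.
  rewrite (derive_comp v (df x Ux) (dg _ (fU _ Ux))) [in RHS](le ('D_v f x)).
  rewrite derive_sumdir; last exact/dg/fU.
  by apply: eq_bigr => i _; rewrite deriveZdir //; exact/dg/fU.
apply: Ck_sum => // i _; apply: Ck_scale => //; first exact: (Ck_clin oU (cl i) (Df v)).
exact: (IH ('D_(e i) g) hf' (Dg (e i))).
Qed.

End Smoothness.

(** * Functions smooth at a point *)

Lemma near_open (T : topologicalType) (x : T) (P : T -> Prop) :
  (\forall y \near x, P y) -> exists B, [/\ open B, B x & forall y, B y -> P y].
Proof.
move=> h; have : nbhs x P := h.
by rewrite nbhsE => -[B [oB Bx] BP]; exists B; split.
Qed.

Lemma near_preimage (S T : topologicalType) (f : S -> T) (x : S) (P : T -> Prop) :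
  {for x, continuous f} -> (\forall z \near f x, P z) -> \forall y \near x, P (f y).
Proof. by move=> cf h; exact: (cf P h). Qed.

Lemma near_openP (T : topologicalType) (x : T) (B : set T) :
  open B -> B x -> \forall y \near x, B y.
Proof. by move=> oB Bx; apply: open_nbhs_nbhs. Qed.

Section SmoothAt.
Context {R : realType}.
Implicit Types V W E : normedModType R.

(** A single neighbourhood serves all orders, which makes the condition open in [x]; it is also the
    form of the local extensions asked for by [smooth_on]. *)
Definition smooth_at V W (f : V -> W) (x : V) : Prop :=
  exists U, [/\ open U, U x & forall k, Ck k U f].

Lemma smooth_at_diff V W (f : V -> W) x : smooth_at f x -> differentiable f x.
Proof. by move=> [U [_ Ux h]]; have [df _] := h 1%N; exact: df. Qed.

Lemma smooth_at_cont V W (f : V -> W) x : smooth_at f x -> {for x, continuous f}.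
Proof. by move=> /smooth_at_diff; exact: differentiable_continuous. Qed.

Lemma smooth_at_near V W (f : V -> W) x :
  smooth_at f x -> \forall y \near x, smooth_at f y.
Proof.
move=> [U [oU Ux h]]; apply: filterS (open_nbhs_nbhs (conj oU Ux)) => y Uy.
by exists U.
Qed.

Lemma smooth_at_eq V W (f g : V -> W) x :
  (\forall y \near x, f y = g y) -> smooth_at f x -> smooth_at g x.
Proof.
move=> /near_open[B [oB Bx BA]] [U [oU Ux h]]; exists (U `&` B).
split=> [||k]; [exact: openI|by []|].
apply: (@Ck_eq _ k V W _ f) => [|y /set_mem[_ /BA]//|]; first exact: openI.
by apply: Ck_sub (h k) => y [].
Qed.

Lemma smooth_at_cst V W (w : W) (x : V) : smooth_at (fun=> w) x.
Proof. by exists setT; split => // [|k]; [exact: openT|exact: Ck_cst]. Qed.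

Lemma smooth_at_add V W (f g : V -> W) x :
  smooth_at f x -> smooth_at g x -> smooth_at (fun y => f y + g y) x.
Proof.
move=> [U [oU Ux hf]] [U' [oU' U'x hg]]; exists (U `&` U'); split=> // [|k].
  exact: openI.
by apply: Ck_add; [exact: openI|apply: Ck_sub (hf k) => y []|apply: Ck_sub (hg k) => y []].
Qed.

Lemma smooth_at_scale V W (a : V -> R) (f : V -> W) x :
  smooth_at a x -> smooth_at f x -> smooth_at (fun y => a y *: f y) x.
Proof.
move=> [U [oU Ux hf]] [U' [oU' U'x hg]]; exists (U `&` U'); split=> // [|k].
  exact: openI.
by apply: Ck_scale; [exact: openI|apply: Ck_sub (hf k) => y []|apply: Ck_sub (hg k) => y []].
Qed.

Lemma smooth_at_mul V (a b : V -> R) x :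
  smooth_at a x -> smooth_at b x -> smooth_at (fun y => a y * b y) x.
Proof. exact: smooth_at_scale. Qed.

Lemma smooth_at_opp V W (f : V -> W) x :
  smooth_at f x -> smooth_at (fun y => - f y) x.
Proof.
move=> sf; under eq_fun do rewrite -scaleN1r.
by apply: smooth_at_scale sf; exact: smooth_at_cst.
Qed.

Lemma smooth_at_sum V W I (r : seq I) (P : pred I) (F : I -> V -> W) x :
  (forall i, P i -> smooth_at (F i) x) ->
  smooth_at (fun y => \sum_(i <- r | P i) F i y) x.
Proof.
move=> h; elim: r => [|i r IH].
  by under eq_fun do rewrite big_nil; exact: smooth_at_cst.
under eq_fun do rewrite big_cons.
case: (boolP (P i)) => [Pi|_]; last exact: IH.
by apply: smooth_at_add => //; exact: h.
Qed.

Lemma smooth_at_prod V I (r : seq I) (P : pred I) (F : I -> V -> R) x :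
  (forall i, P i -> smooth_at (F i) x) ->
  smooth_at (fun y => \prod_(i <- r | P i) F i y) x.
Proof.
move=> h; elim: r => [|i r IH].
  by under eq_fun do rewrite big_nil; exact: smooth_at_cst.
under eq_fun do rewrite big_cons.
case: (boolP (P i)) => [Pi|_]; last exact: IH.
by apply: smooth_at_mul => //; exact: h.
Qed.

Lemma smooth_at_clin V W E (l : {linear E -> W}) (f : V -> E) x :
  continuous l -> smooth_at f x -> smooth_at (fun y => l (f y)) x.
Proof.
by move=> cl [U [oU Ux h]]; exists U; split=> // k; exact: Ck_clin.
Qed.

Lemma smooth_at_lin V W (l : {linear V -> W}) x : continuous l -> smooth_at l x.
Proof.
by move=> cl; exists setT; split=> // [|k]; [exact: openT|apply: Ck_lin => //; exact: openT].
Qed.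

Lemma smooth_at_id V (x : V) : smooth_at (fun y => y) x.
Proof. by apply: (@smooth_at_lin _ _ idfun) => y; exact: cvg_id. Qed.

Lemma smooth_at_derive V W (f : V -> W) v x :
  smooth_at f x -> smooth_at (fun y => 'D_v f y) x.
Proof. by move=> [U [oU Ux h]]; exists U; split=> // k; have [_ Df] := h k.+1; exact: Df. Qed.

Lemma smooth_at_comp_frame V W E N (e : 'I_N -> E) (l : 'I_N -> {linear E -> R})
    (f : V -> E) (g : E -> W) x :
  (forall i, continuous (l i)) -> (forall v, v = \sum_i l i v *: e i) ->
  smooth_at f x -> smooth_at g (f x) -> smooth_at (fun y => g (f y)) x.
Proof.
move=> cl le sf [U' [oU' U'x hg]]; have cf := smooth_at_near sf.
have : \forall y \near x, smooth_at f y /\ U' (f y).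
  near=> y; split; first by near: y.
  near: y; apply: (smooth_at_cont sf); exact: open_nbhs_nbhs.
move=> /near_open[B [oB Bx BA]]; case: sf => U [oU Ux hf].
exists (U `&` B); split=> // [|k]; first exact: openI.
apply: (Ck_comp cl le (openI oU oB) oU') (hg k) => [y [_ /BA[]]//|].
by apply: Ck_sub (hf k) => y [].
Unshelve. all: by end_near. Qed.

(** [R] is not a row space here, so its frame is given by hand: the vector 1, with the identity as
    coordinate. The bump function is composed this way. *)
Lemma smooth_at_compR V W (f : V -> R) (g : R -> W) x :
  smooth_at f x -> smooth_at g (f x) -> smooth_at (fun y => g (f y)) x.
Proof.
apply: (@smooth_at_comp_frame V W R 1 (fun=> 1) (fun=> idfun)) => [i y|v].
  exact: cvg_id.
by rewrite big_ord1 /= [_ *: _]mulr1.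
Qed.

(** A named function, so that reading an entry can carry a linear structure and commute with
    derivatives. *)
Definition mxcoord m n (i : 'I_m) (j : 'I_n) (M : 'M[R]_(m, n)) : R := M i j.

Lemma mxcoord_is_linear m n (i : 'I_m) (j : 'I_n) : linear (mxcoord i j).
Proof. by move=> a u v; rewrite /mxcoord !mxE. Qed.

HB.instance Definition _ m n (i : 'I_m) (j : 'I_n) :=
  GRing.isLinear.Build R 'M[R]_(m, n) R _ (mxcoord i j) (mxcoord_is_linear i j).

Lemma mxcoord_continuous m n (i : 'I_m) (j : 'I_n) : continuous (mxcoord i j).
Proof. exact: coord_continuous. Qed.

Lemma smooth_at_comp V W n (f : V -> 'rV[R]_n) (g : 'rV[R]_n -> W) x :
  smooth_at f x -> smooth_at g (f x) -> smooth_at (fun y => g (f y)) x.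
Proof.
apply: (@smooth_at_comp_frame V W 'rV[R]_n n (fun i => delta_mx 0 i)
  (fun i => mxcoord 0 i)) => [i|v].
  exact: mxcoord_continuous.
exact: row_sum_delta.
Qed.

Lemma smooth_at_coord V m n (f : V -> 'M[R]_(m, n)) x i j :
  smooth_at f x -> smooth_at (fun y => f y i j) x.
Proof.
by move=> sf; apply: (@smooth_at_clin _ _ _ (mxcoord i j) f) => //; exact: mxcoord_continuous.
Qed.

Lemma smooth_at_mx V m n (f : V -> 'M[R]_(m, n)) x :
  (forall i j, smooth_at (fun y => f y i j) x) -> smooth_at f x.
Proof.
move=> h.
have -> : f = (fun y => \sum_i \sum_j f y i j *: delta_mx i j).
  by apply/funext => y; exact: matrix_sum_delta.
do 2![apply: smooth_at_sum => ? _].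
by apply: smooth_at_scale; [exact: h|exact: smooth_at_cst].
Qed.

Lemma derive_coord V m n (f : V -> 'M[R]_(m, n)) x v i j :
  differentiable f x -> ('D_v f x) i j = 'D_v (fun y => f y i j) x.
Proof.
move=> df; have [_ ->//] := derive_clin v (@mxcoord_continuous m n i j) df.
Qed.

Lemma smooth_at_mulmx V m n p (f : V -> 'M[R]_(m, n)) (g : V -> 'M[R]_(n, p)) x :
  smooth_at f x -> smooth_at g x -> smooth_at (fun y => f y *m g y) x.
Proof.
move=> sf sg; apply: smooth_at_mx => i j; under eq_fun do rewrite mxE.
by apply: smooth_at_sum => k _; apply: smooth_at_mul; exact: smooth_at_coord.
Qed.

Lemma derive_mulmx V m n p (f : V -> 'M[R]_(m, n)) (g : V -> 'M[R]_(n, p)) x v :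
  smooth_at f x -> smooth_at g x ->
  'D_v (fun y => f y *m g y) x = f x *m 'D_v g x + 'D_v f x *m g x.
Proof.
move=> sf sg; apply/matrixP => i j.
rewrite derive_coord; last exact/smooth_at_diff/smooth_at_mulmx.
have -> : (fun y => (f y *m g y) i j) = \sum_k (fun y => f y i k *: g y k j).
  by apply/funext => y; rewrite mxE fct_sumE.
have df k : differentiable (fun y => f y i k) x.
  exact/smooth_at_diff/smooth_at_coord.
have dg k : differentiable (fun y => g y k j) x.
  exact/smooth_at_diff/smooth_at_coord.
rewrite derive_sum => [|k]; last first.
  exact/diff_derivable/(derive_scale 0 (df k) (dg k)).1.
rewrite !mxE -big_split /=; apply: eq_bigr => k _.
rewrite (derive_scale v (df k) (dg k)).2 !derive_coord //.
all: exact: smooth_at_diff.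
Qed.

Lemma smooth_at_row_mx V n p (f : V -> 'rV[R]_n) (g : V -> 'rV[R]_p) x :
  smooth_at f x -> smooth_at g x -> smooth_at (fun y => row_mx (f y) (g y)) x.
Proof.
move=> sf sg; apply: smooth_at_mx => i j; case: (split_ordP j) => k ->.
  by under eq_fun do rewrite row_mxEl; exact: smooth_at_coord.
by under eq_fun do rewrite row_mxEr; exact: smooth_at_coord.
Qed.

Lemma smooth_at_lsubmx V n p (f : V -> 'rV[R]_(n + p)) x :
  smooth_at f x -> smooth_at (fun y => lsubmx (f y)) x.
Proof. by move=> sf; apply: smooth_at_clin => //; exact: continuous_lsubmx. Qed.

Lemma smooth_at_rsubmx V n p (f : V -> 'rV[R]_(n + p)) x :
  smooth_at f x -> smooth_at (fun y => rsubmx (f y)) x.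
Proof. by move=> sf; apply: smooth_at_clin => //; exact: continuous_rsubmx. Qed.

Lemma derive_lsubmx V n p (f : V -> 'rV[R]_(n + p)) x v : differentiable f x ->
  'D_v (fun y => lsubmx (f y)) x = lsubmx ('D_v f x).
Proof.
move=> df.
by have [_ ->] := @derive_clin _ _ _ _ lsubmx f x v (@continuous_lsubmx _ _ _ _) df.
Qed.

Lemma derive_rsubmx V n p (f : V -> 'rV[R]_(n + p)) x v : differentiable f x ->
  'D_v (fun y => rsubmx (f y)) x = rsubmx ('D_v f x).
Proof.
move=> df.
by have [_ ->] := @derive_clin _ _ _ _ rsubmx f x v (@continuous_rsubmx _ _ _ _) df.
Qed.

Lemma derive_row_mx V n p (f : V -> 'rV[R]_n) (g : V -> 'rV[R]_p) x v :
  smooth_at f x -> smooth_at g x ->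
  'D_v (fun y => row_mx (f y) (g y)) x = row_mx ('D_v f x) ('D_v g x).
Proof.
move=> sf sg; have /smooth_at_diff dfg := smooth_at_row_mx sf sg.
rewrite -[LHS]hsubmxK -derive_lsubmx // -derive_rsubmx //.
congr (row_mx _ _); congr ('D_v _ x); apply/funext => y.
  by rewrite row_mxKl.
by rewrite row_mxKr.
Qed.

(** The direction varies with [y], whereas [Ck] only handles constant directions. Near [x] the
    derivative is expanded over the standard basis: constant directions with smooth coefficients. *)
Lemma smooth_at_Ddir V W n (g : 'rV[R]_n -> W) (f w : V -> 'rV[R]_n) x :
  smooth_at g (f x) -> smooth_at f x -> smooth_at w x ->
  smooth_at (fun y => 'D_(w y) g (f y)) x.
Proof.
move=> sg sf sw.
apply: (@smooth_at_eq _ _ (fun y => \sum_i w y 0 i *: 'D_(delta_mx 0 i) g (f y))).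
  have h := near_preimage (smooth_at_cont sf) (smooth_at_near sg).
  apply: filterS h => y /smooth_at_diff dg.
  rewrite [in RHS](row_sum_delta (w y)) derive_sumdir //.
  by apply: eq_bigr => i _; rewrite deriveZdir.
apply: smooth_at_sum => i _; apply: smooth_at_scale; first exact: smooth_at_coord.
by apply: (@smooth_at_comp _ _ _ f (fun z => 'D_(delta_mx 0 i) g z)) => //; exact: smooth_at_derive.
Qed.

(** The derivative of 1/f is -(1/f)^2 times that of [f], so order k+1 of the inverse follows from
    order k of the inverse itself and order k+1 of [f]. *)
Lemma smooth_at_inv V (f : V -> R) x : smooth_at f x -> f x != 0 ->
  smooth_at (fun y => (f y)^-1) x.
Proof.
move=> sf fx0.
have : \forall y \near x, smooth_at f y /\ f y != 0.
  near=> y; split; first by near: y; exact: smooth_at_near.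
  near: y; apply: (near_preimage (P := fun z => z != 0) (smooth_at_cont sf)).
  by apply: (near_openP (B := [set z : R | z != 0])) fx0; exact: open_neq.
move=> /near_open[B [oB Bx BA]]; exists B; split=> // k.
(* Each point of [B] comes with its own neighbourhood of smoothness; locality of [Ck] puts them
   together. *)
have CB j : Ck j B f.
  apply: Ck_local => y /BA[[U [oU Uy h]] _]; exists U; split=> //.
elim: k => [y By|k IH].
  by apply: cvgV; [exact: (BA _ By).2|exact: (CB 0%N)].
split=> [y By|v].
  by apply: differentiableV; [exact: (CB 1%N).1|exact: (BA _ By).2].
apply: (@Ck_eq _ _ _ _ _
  (fun y => (- 1) *: (((f y)^-1 *: (f y)^-1) *: 'D_v f y))) => //.
  move=> y /set_mem By; have df : differentiable f y by exact: (CB 1%N).1.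
  rewrite deriveV; [|exact: (BA _ By).2|exact: diff_derivable].
  by rewrite scaleN1r scaleNr -exprVn expr2.
apply: Ck_scale => //; first exact: Ck_cst.
by do 2?apply: Ck_scale => //; exact: (CB k.+1).2.
Unshelve. all: by end_near. Qed.

Lemma smooth_at_det V n (f : V -> 'M[R]_n) x :
  smooth_at f x -> smooth_at (fun y => \det (f y)) x.
Proof.
move=> sf; apply: smooth_at_sum => s _; apply: smooth_at_mul.
  exact: smooth_at_cst.
by apply: smooth_at_prod => i _; exact: smooth_at_coord.
Qed.

Lemma near_unitmx V n (f : V -> 'M[R]_n) x :
  smooth_at f x -> f x \in unitmx -> \forall y \near x, f y \in unitmx.
Proof.
move=> sf; rewrite unitmxE unitfE => fx.
have : \forall y \near x, \det (f y) != 0.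
  apply: (near_preimage (P := fun z => z != 0) (smooth_at_cont (smooth_at_det sf))).
  by apply: (near_openP (B := [set z : R | z != 0])) fx; exact: open_neq.
by apply: filterS => y; rewrite unitmxE unitfE.
Qed.

Lemma smooth_at_invmx V n (f : V -> 'M[R]_n) x : smooth_at f x ->
  f x \in unitmx -> smooth_at (fun y => invmx (f y)) x.
Proof.
(* Cramer's rule, used only near [x], where [f y] stays invertible: on singular matrices [invmx]
   returns its argument. *)
move=> sf fx; apply: (@smooth_at_eq _ _ (fun y => (\det (f y))^-1 *: \adj (f y))).
  by apply: filterS (near_unitmx sf fx) => y fy; rewrite /invmx fy.
apply: smooth_at_scale.
  by apply: smooth_at_inv; [exact: smooth_at_det|rewrite -unitfE -unitmxE].
apply: smooth_at_mx => i j; under eq_fun do rewrite mxE.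
apply: smooth_at_mul; first exact: smooth_at_cst.
apply: smooth_at_det; apply: smooth_at_mx => a b; under eq_fun do rewrite !mxE.
exact: smooth_at_coord.
Qed.

Lemma smooth_on_at V W (S : set V) (f : V -> W) x :
  open S -> smooth_on S f -> S x -> smooth_at f x.
Proof.
move=> oS sf Sx; have [U [g [oU Ux hg fg]]] := sf x Sx.
exists (S `&` U); split=> // [|k]; first exact: openI.
apply: (@Ck_eq _ _ _ _ _ g); first exact: openI.
  by move=> y yS; rewrite fg.
by apply: Ck_sub (hg k) => y [].
Qed.

(** Serves above all for sets that are not open, such as the constraint set: [g] is compared with
    [f] at points of [S] only, so the values of [f] elsewhere never matter. *)
Lemma smooth_on_ext V W (S : set V) (f : V -> W) :
  (forall x, S x -> exists2 g, smooth_at g x & \forall y \near x, S y -> f y = g y) ->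
  smooth_on S f.
Proof.
move=> h x /h[g [U [oU Ux hg]]] /near_open[B [oB Bx BA]].
exists (U `&` B), g; split=> // [|k|y /set_mem[Sy [_ By]]]; first exact: openI.
  by apply: Ck_sub (hg k) => y [].
exact: BA.
Qed.

End SmoothAt.

(** * Symmetry of second derivatives and bump functions *)

Section Schwarz.
Context {R : realType} {V : normedModType R}.

Lemma derive_line (g : V -> R) (x u : V) (s : R) :
  differentiable g (x + s *: u) ->
  is_derive s 1 (fun r : R => g (x + r *: u)) ('D_u g (x + s *: u)).
Proof.
move=> dg.
have did : differentiable (fun r : R => r) s by have [] := is_diff_id s.
have [ds Ds] := @derive_scale R R V (fun r => r) (fun=> u) s 1 did (differentiable_cst u s).
have ds1 : derivable (fun r : R => r *: u) s 1 := diff_derivable ds.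
have dl : differentiable (fun r : R => x + r *: u) s.
  by apply: differentiableD; first exact: differentiable_cst.
have Dl : 'D_1 (fun r : R => x + r *: u) s = u.
  have [_ ->] := is_deriveD (is_derive_cst x s 1) (derivableP ds1).
  by rewrite add0r Ds derive_id derive_cst_fun scaler0 add0r scale1r.
split; first exact/diff_derivable/(differentiable_comp dl dg).
by have := derive_comp (1 : R) dl dg; rewrite Dl.
Qed.

Lemma line_MVT (g : V -> R) (x u : V) (t : R) : 0 < t ->
  (forall s, 0 <= s <= t -> differentiable g (x + s *: u)) ->
  exists2 s, 0 < s < t & g (x + t *: u) - g x = t * 'D_u g (x + s *: u).
Proof.
move=> t0 dg.
have [||c] := @MVT R (fun r : R => g (x + r *: u)) (fun s => 'D_u g (x + s *: u)) 0 t t0.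
- move=> s; rewrite in_itv /= => /andP[s0 st]; apply: derive_line; apply: dg.
  by rewrite !ltW.
- apply: derivable_within_continuous => s; rewrite in_itv /= => s0.
  by have [] := derive_line (dg s s0).
rewrite in_itv /= => ct; rewrite scale0r addr0 subr0 => e.
by exists c => //; rewrite e mulrC.
Qed.

(** Two uses of the mean value theorem: along [u] for the increment [f (y + t *: v) - f y], then
    along [v] for ['D_u f]. The second difference is symmetric in [u] and [v], so exchanging them
    expresses the same number by the other mixed derivative. *)
Lemma second_difference (f : V -> R) (x u v : V) (t : R) : 0 < t ->
  (forall s r, 0 <= s <= t -> 0 <= r <= t -> smooth_at f (x + s *: u + r *: v)) ->
  exists s r, [/\ 0 <= s <= t, 0 <= r <= t &
    f (x + t *: u + t *: v) - f (x + t *: u) - (f (x + t *: v) - f x)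
    = t * (t * 'D_v (fun y => 'D_u f y) (x + s *: u + r *: v))].
Proof.
move=> t0 sf.
have t00 : 0 <= (0 : R) <= t by rewrite lexx ltW.
have tt : 0 <= t <= t by rewrite lexx ltW.
have sf0 s : 0 <= s <= t -> smooth_at f (x + s *: u).
  by move=> hs; have := sf s 0 hs t00; rewrite scale0r addr0.
pose g y := f (y + t *: v) - f y.
have dsh y : differentiable (fun z : V => z + t *: v) y.
  by apply: differentiableD; [have [] := is_diff_id y|exact: differentiable_cst].
have Dsh y w : 'D_w (fun z : V => z + t *: v) y = w.
  have [_] := is_deriveD (is_derive_id y w) (is_derive_cst (t *: v) y w).
  by rewrite addr0.
have dft s : 0 <= s <= t -> differentiable (fun z => f (z + t *: v)) (x + s *: u).
  move=> hs; apply: (differentiable_comp (dsh _)).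
  by apply: smooth_at_diff; exact: sf.
have [s st e1] : exists2 s, 0 < s < t & g (x + t *: u) - g x = t * 'D_u g (x + s *: u).
  apply: line_MVT => // s hs; apply: differentiableB; first exact: dft.
  exact/smooth_at_diff/sf0.
have hs : 0 <= s <= t by case/andP: st => *; rewrite !ltW.
have e2 : 'D_u g (x + s *: u) = 'D_u f (x + s *: u + t *: v) - 'D_u f (x + s *: u).
  rewrite [LHS](@deriveB _ _ _ (fun z => f (z + t *: v)) f); last 2 first.
  - exact/diff_derivable/dft.
  - exact/diff_derivable/smooth_at_diff/sf0.
  congr (_ - _).
  have := derive_comp u (dsh (x + s *: u)) (smooth_at_diff (sf _ _ hs tt)).
  by rewrite Dsh.
have [r rt e3] : exists2 r, 0 < r < t &
    'D_u f (x + s *: u + t *: v) - 'D_u f (x + s *: u)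
    = t * 'D_v (fun y => 'D_u f y) (x + s *: u + r *: v).
  apply: (@line_MVT (fun y => 'D_u f y)) => // r hr.
  exact/smooth_at_diff/smooth_at_derive/sf.
exists s, r; split => //; first by case/andP: rt => *; rewrite !ltW.
by rewrite -e3 -e2 -e1 /g.
Qed.

Lemma small_parallelogram (x u v : V) (P : V -> Prop) :
  (\forall y \near x, P y) -> exists2 t : R, 0 < t &
    forall s r, 0 <= s <= t -> 0 <= r <= t -> P (x + s *: u + r *: v).
Proof.
(* The summand 1 keeps [c] positive when [u] and [v] vanish; the factor 1/2 in the side [e / c / 2]
   makes the distance to [x] strictly less than [e]. *)
move=> /nbhs_ballP[e /= e0 eP]; pose c := `|u| + `|v| + 1.
have c0 : 0 < c by rewrite ltr_wpDl // addr_ge0.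
exists (e / c / 2); first by rewrite !divr_gt0.
move=> s r /andP[s0 st] /andP[r0 rt]; apply: eP.
rewrite -ball_normE /= -addrA opprD addNKr normrN.
apply: le_lt_trans (ler_normD _ _) _; rewrite !normrZ !ger0_norm //.
have h : s * `|u| + r * `|v| <= e / c / 2 * c.
  rewrite /c !mulrDr mulr1; apply: ler_wpDr; first by rewrite ltW // !divr_gt0.
  by apply: lerD; exact: ler_wpM2r.
apply: le_lt_trans h _; rewrite mulrAC divfK ?gt_eqF //.
by rewrite ltr_pdivrMr // ltr_pMr // ltr1n.
Qed.

Lemma half_dist_false (a b w : R) :
  `|a - w| < `|a - b| / 2 -> `|b - w| < `|a - b| / 2 -> False.
Proof.
move=> ha hb; have : `|a - b| < `|a - b| / 2 + `|a - b| / 2.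
  have {1}-> : a - b = (a - w) - (b - w) by ring.
  by apply: le_lt_trans (ler_normB _ _) _; exact: ltrD.
by rewrite -splitr ltxx.
Qed.

(** If the mixed derivatives differed at [x], continuity would keep each of them within half of the
    gap from its value at [x] on a small parallelogram; there the two readings of one second
    difference provide a common value, a contradiction. *)
Lemma derive_comm_real (f : V -> R) (x u v : V) : smooth_at f x ->
  'D_u (fun y => 'D_v f y) x = 'D_v (fun y => 'D_u f y) x.
Proof.
move=> sf; apply/eqP/negPn/negP => ne.
set a := 'D_u _ x in ne; set b := 'D_v _ x in ne.
pose e := `|a - b| / 2.
have e0 : 0 < e by rewrite divr_gt0 // normr_gt0 subr_eq0.
have ca := smooth_at_cont (smooth_at_derive u (smooth_at_derive v sf)).
have cb := smooth_at_cont (smooth_at_derive v (smooth_at_derive u sf)).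
have : \forall y \near x, smooth_at f y /\
   (`|a - 'D_u (fun y => 'D_v f y) y| < e /\ `|b - 'D_v (fun y => 'D_u f y) y| < e).
  apply: filterI; first exact: smooth_at_near.
  apply: filterI.
    by move/cvgrPdist_lt : ca; apply.
  by move/cvgrPdist_lt : cb; apply.
move=> /(small_parallelogram u v)[t t0 ht].
have [s [r [hs hr e1]]] := second_difference t0 (fun s r hs hr => (ht s r hs hr).1).
have [|s' [r' [hs' hr' e2]]] := @second_difference f x v u t t0.
  by move=> s' r' hs' hr'; rewrite addrAC; exact: (ht r' s' hr' hs').1.
have e3 : 'D_u (fun y => 'D_v f y) (x + s' *: v + r' *: u) =
          'D_v (fun y => 'D_u f y) (x + s *: u + r *: v).
  have tn : t != 0 by rewrite gt_eqF.
  apply: (mulfI tn); apply: (mulfI tn); apply: etrans (esym e2) (etrans _ e1).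
  by rewrite [x + t *: v + t *: u]addrAC; ring.
have ha : `|a - 'D_u (fun y => 'D_v f y) (x + s' *: v + r' *: u)| < e.
  by have h := (ht _ _ hr' hs').2.1; rewrite (addrAC x (r' *: u)) in h.
have [_ [_ hb]] := ht _ _ hs hr.
rewrite e3 in ha.
exact: (half_dist_false ha hb).
Qed.

Lemma derive_comm m n (f : V -> 'M[R]_(m, n)) (x u v : V) : smooth_at f x ->
  'D_u (fun y => 'D_v f y) x = 'D_v (fun y => 'D_u f y) x.
Proof.
move=> sf.
have D2 w w' i j : ('D_w (fun y => 'D_w' f y) x) i j
    = 'D_w (fun y => 'D_w' (fun z => f z i j) y) x.
  rewrite derive_coord; last exact/smooth_at_diff/smooth_at_derive.
  apply: near_eq_derive; apply: filterS (smooth_at_near sf) => y /smooth_at_diff df.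
  by rewrite derive_coord.
apply/matrixP => i j; apply: etrans (D2 u v i j) (etrans _ (esym (D2 v u i j))).
by apply: derive_comm_real; exact: smooth_at_coord.
Qed.

End Schwarz.

Section Bump.
Context {R : realType}.

(* The factor [s ^- k] makes the family stable under differentiation. *)
Definition flat (k : nat) (s : R) : R :=
  if 0 < s then s^-1 ^+ k * expR (- s^-1) else 0.

Lemma flat_ge0 k s : 0 <= flat k s.
Proof.
rewrite /flat; case: ifP => // s0.
by rewrite mulr_ge0 ?expR_ge0 // exprn_ge0 // invr_ge0 ltW.
Qed.

(** Comes from [1 + x^(k+1)/(k+1)! <= exp x] at [x = 1/s]. The bound is linear in [s], which gives
    continuity at 0 for every [k]. *)
Lemma flat_le k s : flat k s <= k.+1`!%:R * `|s|.
Proof.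
rewrite /flat; case: ifP => [s0|_]; last by rewrite mulr_ge0.
have si : 0 < s^-1 by rewrite invr_gt0.
have h : s^-1 ^+ k.+1 <= k.+1`!%:R * expR s^-1.
  rewrite mulrC -ler_pdivrMr ?ltr0n ?fact_gt0 //.
  by apply: le_trans (expR_ge1Dxn k (ltW si)); rewrite lerDr.
rewrite (gtr0_norm s0) expRN ler_pdivrMr ?expR_gt0 //.
rewrite mulrAC -ler_pdivrMr //.
by rewrite -exprSr.
Qed.

(** Makes the difference quotient of [flat k] at 0 equal to [flat k.+1], whose limit there is 0. *)
Lemma flatS k s : flat k s = s * flat k.+1 s.
Proof.
rewrite /flat; case: ifP => [s0|_]; last by rewrite mulr0.
by rewrite exprS !mulrA divff ?mul1r // gt_eqF.
Qed.

Lemma flat0 k : flat k 0 = 0. Proof. by rewrite /flat ltxx. Qed.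

Lemma flat_cont0 k : {for 0, continuous (flat k)}.
Proof.
rewrite /prop_for /continuous_at flat0.
apply/cvgrPdist_le => e e0; near=> s.
rewrite sub0r normrN ger0_norm ?flat_ge0 //; apply: le_trans (flat_le k s) _.
have N0 : 0 < k.+1`!%:R :> R by rewrite ltr0n fact_gt0.
rewrite -ler_pdivlMl //; near: s. apply: (@nbhs0_le R R).
by rewrite mulr_gt0 // invr_gt0.
Unshelve. all: by end_near. Qed.

Lemma flat_is_derive k (s : R) :
  is_derive s 1 (flat k) (flat k.+2 s - k%:R * flat k.+1 s).
Proof.
have [s0|s0|->] := ltgtP s 0.
- have z : \forall r \near s, 0 = flat k r.
    have : \forall r \near s, r < 0 by exact: lt_nbhsl.
    by apply: filterS => r r0; rewrite /flat ltNge ltW.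
  apply: (near_eq_is_derive z); rewrite /flat !ltNge ltW //= mulr0 subr0.
  exact: is_derive_cst.
- have z : \forall r \near s, r^-1 ^+ k * expR (- r^-1) = flat k r.
    have : \forall r \near s, 0 < r by exact: lt_nbhsr.
    by apply: filterS => r r0; rewrite /flat r0.
  apply: (near_eq_is_derive z); rewrite /flat s0.
  have sn : s != 0 by rewrite gt_eqF.
  have dv : is_derive s 1 (fun r : R => r^-1) (- s ^- 2).
    split; first exact: (@derivableV _ _ id).
    by rewrite (@deriveV _ _ id) // derive_id [_ *: _]mulr1.
  have dX := is_deriveX k dv.
  have dE : is_derive s 1 (fun r : R => expR (- r^-1)) (expR (- s^-1) * s ^- 2).
    have := @is_derive1_comp R expR (fun r => - r^-1) s _ _ (is_derive_expR (- s^-1))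
      (is_deriveN dv : is_derive s 1 (fun r : R => - r^-1) _).
    by rewrite opprK.
  have -> : (fun r : R => r^-1 ^+ k * expR (- r^-1)) =
      (fun r : R => r^-1) ^+ k * (fun r => expR (- r^-1)).
    by apply/funext => r; rewrite !fctE.
  apply: is_derive_eq (is_deriveM dX dE) _.
  rewrite /GRing.scale /= -!exprVn !fctE.
  (* The power rule involves the predecessor of [k], so [k = 0] is treated apart. *)
  case: k {z dX} => [|k] /=; first by rewrite !mulr0n; ring.
  by rewrite -mulr_natl !exprS; ring.
rewrite !flat0 mulr0 subrr; split.
  apply/cvg_ex; exists 0.
  have : flat k.+1 h @[h --> 0^'] --> (0 : R).
    rewrite -[X in _ --> X](flat0 k.+1); apply: cvg_within_filter.
    exact: flat_cont0.
  apply: cvg_trans; apply: near_eq_cvg; near=> h.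
  rewrite /= flat0 subr0 addr0 [h *: 1]mulr1 (flatS k h).
  rewrite [RHS]mulrA mulVf ?mul1r //.
  by near: h; exact: nbhs_dnbhs_neq.
apply/cvg_lim => //.
have : flat k.+1 h @[h --> 0^'] --> (0 : R).
  rewrite -[X in _ --> X](flat0 k.+1); apply: cvg_within_filter.
  exact: flat_cont0.
apply: cvg_trans; apply: near_eq_cvg; near=> h.
rewrite /= flat0 subr0 addr0 [h *: 1]mulr1 (flatS k h).
rewrite [RHS]mulrA mulVf ?mul1r //.
by near: h; exact: nbhs_dnbhs_neq.
Unshelve. all: by end_near. Qed.

Lemma flat_smooth k (s : R) : smooth_at (flat k) s.
Proof.
exists setT; split=> // [|j]; first exact: openT.
elim: j k => [|j IH] k.
  move=> x _; have [d _] := flat_is_derive k x.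
  exact/differentiable_continuous/derivable1_diffP.
have df x : differentiable (flat k) x.
  by apply/derivable1_diffP; have [] := flat_is_derive k x.
split=> // v.
apply: (@Ck_eq _ _ _ _ _ (fun x => v *: (flat k.+2 x + (- k%:R) *: flat k.+1 x))).
- exact: openT.
- move=> x _; rewrite -[in RHS](mulr1 v) [RHS]deriveZdir //.
  by have [_ ->] := flat_is_derive k x; rewrite scaleNr.
apply: Ck_scale; [exact: openT|exact: Ck_cst|].
apply: Ck_add; [exact: openT|exact: IH|].
by apply: Ck_scale; [exact: openT|exact: Ck_cst|exact: IH].
Qed.

(** The norm of ['rV[R]_n] is the sup norm, not smooth in general, so the bump is built on [q], the
    squared Euclidean distance to [x0]. The Euclidean ball of radius [d] lies in the closed sup ball
    of radius [d], taken as [K]; halving [e] puts this closed ball inside the open one. *)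
Lemma rV_bump n (x0 : 'rV[R]_n) (B : set 'rV[R]_n) : open B -> B x0 ->
  exists h : 'rV[R]_n -> R, exists K : set 'rV[R]_n,
    [/\ forall x, smooth_at h x, h x0 != 0, compact K, K `<=` B
      & forall x, ~ K x -> h x = 0].
Proof.
move=> oB Bx0; have /nbhs_ballP[e /= e0 eB] := open_nbhs_nbhs (conj oB Bx0).
pose d := e / 2; have d0 : 0 < d by rewrite divr_gt0.
pose q (x : 'rV[R]_n) := \sum_i (x 0 i - x0 0 i) * (x 0 i - x0 0 i).
exists (fun x => flat 0 (d * d - q x)), (closed_ball x0 d); split.
- move=> x; apply: (@smooth_at_compR R _ _ (fun x => d * d - q x)); last exact: flat_smooth.
  apply: smooth_at_add; first exact: smooth_at_cst.
  apply/smooth_at_opp/smooth_at_sum => i _.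
  have h : smooth_at (fun x : 'rV[R]_n => x 0 i - x0 0 i) x.
    apply: smooth_at_add; last exact: smooth_at_cst.
    by apply: smooth_at_coord; exact: smooth_at_id.
  exact: smooth_at_mul.
- rewrite /q big1 => [|i _]; last by rewrite subrr mulr0.
  rewrite subr0 /flat mulr_gt0 // expr0 mul1r gt_eqF //; exact: expR_gt0.
- apply: bounded_closed_compact; last exact: closed_ball_closed.
  rewrite closed_ballE //; exists (`|x0| + d); split; first exact: num_real.
  move=> M hM x /= xd; apply: le_trans (ltW hM).
  have -> : x = x0 - (x0 - x) by rewrite opprB addrC subrK.
  by apply: le_trans (ler_normB _ _) _; rewrite lerD2l.
- rewrite closed_ballE // => x /= xd; apply: eB; rewrite -ball_normE /=.
  by apply: le_lt_trans xd _; rewrite /d ltr_pdivrMr // ltr_pMr // ltr1n.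
move=> x; rewrite closed_ballE //= => xK; rewrite /flat ifF //.
apply/negbTE; rewrite -leNgt subr_le0 leNgt; apply/negP => qd; apply: xK.
suff h j : `|(x0 - x) 0 j| <= d.
  change (mx_norm (x0 - x) <= d); rewrite mx_normrE.
  by apply: bigmax_le => [|[i j] _] /=; [exact: ltW|rewrite (ord1 i); exact: h].
rewrite !mxE /= -(ler_pXn2r (_ : 0 < 2)%N) ?nnegrE ?(ltW d0) //.
rewrite real_normK ?num_real // -sqrrN opprB !expr2; apply: le_trans (ltW qd).
rewrite /q (bigD1 j) //= lerDl sumr_ge0 // => k _.
by rewrite -expr2 sqr_ge0.
Qed.

End Bump.

(** * Charts and tangent charts *)

Section DirectionalFields.
Context {R : realType}.
Implicit Types V W : normedModType R.

(** One term differentiates the direction, the other is a second derivative with the direction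
    frozen. The computations with tangent lifts and with the Lagrange equation rest on this rule,
    proved by expanding [w] over the standard basis. *)
Lemma derive_Ddir V W n (g : 'rV[R]_n -> W) (f w : V -> 'rV[R]_n) (x v : V) :
  smooth_at g (f x) -> smooth_at f x -> smooth_at w x ->
  'D_v (fun y => 'D_(w y) g (f y)) x =
  'D_('D_v w x) g (f x) + 'D_('D_v f x) (fun z => 'D_(w x) g z) (f x).
Proof.
move=> sg sf sw; pose e i : 'rV[R]_n := delta_mx 0 i.
have sge i : smooth_at (fun z => 'D_(e i) g z) (f x) by exact: smooth_at_derive.
have sgf i : smooth_at (fun y => 'D_(e i) g (f y)) x.
  exact: (@smooth_at_comp _ _ _ _ f (fun z => 'D_(e i) g z)).
have swi i : smooth_at (fun y => w y 0 i) x by exact: smooth_at_coord.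
have expand y u : differentiable g y ->
    'D_u g y = (\sum_i (fun y => u 0 i *: 'D_(e i) g y)) y.
  move=> dg; rewrite fct_sumE {1}(row_sum_delta u) derive_sumdir //.
  by apply: eq_bigr => i _; rewrite deriveZdir.
have -> : 'D_v (fun y => 'D_(w y) g (f y)) x =
    'D_v (\sum_i (fun y => w y 0 i *: 'D_(e i) g (f y))) x.
  apply: near_eq_derive.
  have h := near_preimage (smooth_at_cont sf) (smooth_at_near sg).
  apply: filterS h => y /smooth_at_diff dg.
  by rewrite (expand _ _ dg) !fct_sumE.
rewrite derive_sum => [|i]; last first.
  exact/diff_derivable/smooth_at_diff/smooth_at_scale.
have -> : 'D_('D_v f x) (fun z => 'D_(w x) g z) (f x) =
    'D_('D_v f x) (\sum_i (fun z => w x 0 i *: 'D_(e i) g z)) (f x).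
  apply: near_eq_derive; apply: filterS (smooth_at_near sg) => y /smooth_at_diff dg.
  exact: expand.
rewrite derive_sum => [|i]; last first.
  apply/diff_derivable/smooth_at_diff/smooth_at_scale => //.
  exact: smooth_at_cst.
rewrite (expand _ _ (smooth_at_diff sg)) fct_sumE -big_split /=.
apply: eq_bigr => i _.
have [_ D1] := derive_scale v (smooth_at_diff (swi i)) (smooth_at_diff (sgf i)).
have D2 : 'D_('D_v f x) (fun z => w x 0 i *: 'D_(e i) g z) (f x) =
    w x 0 i *: 'D_('D_v f x) (fun z => 'D_(e i) g z) (f x).
  exact/deriveZ/diff_derivable/smooth_at_diff.
rewrite D1 D2 addrC; congr (_ + _).
  congr (_ *: _).
  exact: (derive_comp v (smooth_at_diff sf) (smooth_at_diff (sge i))).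
by rewrite derive_coord //; exact: smooth_at_diff.
Qed.

End DirectionalFields.

Section Charts.
Context {R : realType} {n : nat} {M : topologicalType} {A : atlas R n M}.
Context (hM : smooth_manifold A).
Implicit Types (c : chart R n M) (q : M).

Definition trans c c' : 'rV[R]_n -> 'rV[R]_n := cmap c' \o cinv c.

Lemma chart_atP q : charts A (chart_at A q).
Proof. by have [] := manifold_chart_at hM q. Qed.

Lemma chart_at_dom q : cdom (chart_at A q) q.
Proof. by have [] := manifold_chart_at hM q. Qed.

Lemma cmapK c q : charts A c -> cdom c q -> cinv c (cmap c q) = q.
Proof. by move=> /(manifold_charts hM)/homeo_chartK h /mem_set /h. Qed.

(** Lets a statement about vectors near [cmap c q] be read on points of the manifold, where [cinv c]
    cancels and its values off the chart image are never met. Openness of the image and continuity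
    of [cinv c] give it. *)
Lemma near_chart c q (B : set M) : charts A c -> cdom c q -> open B -> B q ->
  \forall x \near cmap c q, exists q', [/\ cdom c q', B q' & x = cmap c q'].
Proof.
move=> cA cq oB Bq; have hc := manifold_charts hM cA.
have qi : (cmap c @` cdom c) (cmap c q) by exists q.
have oi := homeo_chart_img hc.
have cont : {for cmap c q, continuous (cinv c)}.
  exact: (homeo_chart_inv_cont hc (mem_set qi)).
have nB : \forall x \near cmap c q, B (cinv c x).
  by apply: (near_preimage cont); rewrite cmapK //; exact: near_openP.
have nI := near_openP oi qi.
apply: filterS2 nB nI => x Bx [q' cq' e]; exists q'; split => //.
by rewrite -(cmapK cA cq') e.
Qed.

Lemma open_chart_img c (B : set M) : charts A c -> open B ->
  open (cmap c @` (cdom c `&` B)).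
Proof.
move=> cA oB; rewrite openE => _ [q [cq Bq] <-].
have := near_chart cA cq oB Bq.
by apply: filterS => x [q' [cq' Bq' ->]]; exists q'.
Qed.

Lemma dom_open c : charts A c -> open (cdom c).
Proof. by move=> /(manifold_charts hM)/homeo_chart_dom. Qed.

Lemma trans_smooth c c' q : charts A c -> charts A c' -> cdom c q -> cdom c' q ->
  smooth_at (trans c c') (cmap c q).
Proof.
move=> cA cA' cq cq'.
apply: (smooth_on_at _ (manifold_compatible hM cA cA')); last by exists q.
exact: open_chart_img (dom_open cA').
Qed.

(** Near the point, two successive coordinate changes compose to a third one, and the chain rule
    applies. This makes [components] consistent between charts and invertible. *)
Lemma trans_chain c c' c'' q v : charts A c -> charts A c' -> charts A c'' ->
  cdom c q -> cdom c' q -> cdom c'' q ->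
  'D_('D_v (trans c c') (cmap c q)) (trans c' c'') (cmap c' q) =
  'D_v (trans c c'') (cmap c q).
Proof.
move=> cA cA' cA'' cq cq' cq''.
have e : trans c c' (cmap c q) = cmap c' q by rewrite /trans /= cmapK.
have d1 := smooth_at_diff (trans_smooth cA cA' cq cq').
have d2 := smooth_at_diff (trans_smooth cA' cA'' cq' cq'').
rewrite -e in d2 *; rewrite -(derive_comp v d1 d2); apply: near_eq_derive.
have := near_chart cA cq (dom_open cA') cq'.
by apply: filterS => _ [q' [h h' ->]]; rewrite /trans /= cmapK // cmapK.
Qed.

Lemma trans_same c q v : charts A c -> cdom c q ->
  'D_v (trans c c) (cmap c q) = v.
Proof.
move=> cA cq; rewrite -[RHS](derive_id (cmap c q) v); apply: near_eq_derive.
have := near_chart cA cq (dom_open cA) cq.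
by apply: filterS => _ [q' [h h' ->]]; rewrite /trans /= cmapK.
Qed.

Lemma componentsE c q v :
  components A c q v = 'D_v (trans (chart_at A q) c) (cmap (chart_at A q) q).
Proof. by []. Qed.

Lemma components_trans c c' q v : charts A c -> charts A c' -> cdom c q -> cdom c' q ->
  components A c' q v = 'D_(components A c q v) (trans c c') (cmap c q).
Proof.
move=> cA cA' cq cq'; rewrite !componentsE trans_chain //.
- exact: chart_atP.
- exact: chart_at_dom.
Qed.

Lemma components_chart_at q v : components A (chart_at A q) q v = v.
Proof. by rewrite componentsE trans_same //; [exact: chart_atP|exact: chart_at_dom]. Qed.

Lemma components_diff c q : charts A c -> cdom c q ->
  differentiable (trans (chart_at A q) c) (cmap (chart_at A q) q).
Proof.
move=> cA cq; apply: smooth_at_diff; apply: trans_smooth => //.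
- exact: chart_atP.
- exact: chart_at_dom.
Qed.

Lemma components0 c q : components A c q 0 = 0.
Proof. by rewrite componentsE derive0. Qed.

Lemma components_sum c q I (r : seq I) (P : pred I) (k : I -> R) (F : I -> 'rV[R]_n) :
  charts A c -> cdom c q ->
  components A c q (\sum_(i <- r | P i) k i *: F i) =
  \sum_(i <- r | P i) k i *: components A c q (F i).
Proof.
move=> cA cq; have d := components_diff cA cq.
rewrite componentsE derive_sumdir //.
by apply: eq_bigr => i _; rewrite deriveZdir.
Qed.

Lemma componentsZ c q (k : R) v : charts A c -> cdom c q ->
  components A c q (k *: v) = k *: components A c q v.
Proof. by move=> cA cq; rewrite componentsE deriveZdir //; exact: components_diff. Qed.

Lemma componentsK c q v : charts A c -> cdom c q ->
  components A c q ('D_v (trans c (chart_at A q)) (cmap c q)) = v.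
Proof.
move=> cA cq; rewrite componentsE trans_chain ?trans_same //.
- exact: chart_atP.
- exact: chart_at_dom.
Qed.

Lemma Kcomponents c q v : charts A c -> cdom c q ->
  'D_(components A c q v) (trans c (chart_at A q)) (cmap c q) = v.
Proof.
move=> cA cq; rewrite -components_trans ?components_chart_at //.
- exact: chart_atP.
- exact: chart_at_dom.
Qed.

Lemma components_eq0 c q v : charts A c -> cdom c q ->
  components A c q v = 0 -> v = 0.
Proof. by move=> cA cq e; rewrite -(Kcomponents v cA cq) e derive0. Qed.

Lemma local_field_smooth c q (U : set M) (Z : M -> 'rV[R]_n) :
  smooth_vfield A U Z -> open U -> U q -> charts A c -> cdom c q ->
  smooth_at (local_field A c Z) (cmap c q).
Proof.
move=> sZ oU Uq cA cq; apply: (smooth_on_at _ (sZ c cA)); last by exists q.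
exact: open_chart_img.
Qed.

Lemma local_field_cmap c q (Z : M -> 'rV[R]_n) : charts A c -> cdom c q ->
  local_field A c Z (cmap c q) = components A c q (Z q).
Proof. by move=> cA cq; rewrite /local_field cmapK. Qed.

(** * Tangent charts and lifts of vector fields *)

Local Notation TA := (tangent_atlas A).
Local Notation tc := (tangent_chart A).
Implicit Type p : M * 'rV[R]_n.

Lemma tcmapK c p : charts A c -> cdom c p.1 -> cinv (tc c) (cmap (tc c) p) = p.
Proof.
case: p => q u cA /= cq; rewrite row_mxKl row_mxKr cmapK //; congr (_, _).
exact: (Kcomponents u cA cq).
Qed.

Lemma tcinvK c q w : charts A c -> cdom c q ->
  let p := cinv (tc c) (row_mx (cmap c q) w) in
  p.1 = q /\ cmap (tc c) p = row_mx (cmap c q) w.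
Proof.
move=> cA cq /=; rewrite row_mxKl row_mxKr cmapK //; split => //.
by congr row_mx; exact: (componentsK w cA cq).
Qed.

(** A tangent chart contains whole fibres, so only the base point has to be localised and the fibre
    coordinate of [z] is arbitrary. *)
Lemma near_tchart c p (B : set M) : charts A c -> cdom c p.1 -> open B -> B p.1 ->
  \forall z \near cmap (tc c) p, exists p', [/\ cdom c p'.1, B p'.1 & z = cmap (tc c) p'].
Proof.
move=> cA cq oB Bq.
have h : \forall z \near cmap (tc c) p,
    exists q', [/\ cdom c q', B q' & lsubmx z = cmap c q'].
  apply: (near_preimage (P := fun x => exists q', [/\ cdom c q', B q' & x = cmap c q'])).
    exact: continuous_lsubmx.
  by rewrite row_mxKl; exact: near_chart.
apply: filterS h => z [q' [cq' Bq' e]].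
have [e1 e2] := tcinvK (rsubmx z) cA cq'.
exists (cinv (tc c) (row_mx (cmap c q') (rsubmx z))).
by rewrite e1 e2 -e hsubmxK.
Qed.

(** The tangent map of [psi]. The literal transition map between tangent charts passes through the
    preferred chart of a moving point; this expression does not, so its smoothness is visible, and
    the two agree near each point. *)
Definition tlift_map (psi : 'rV[R]_n -> 'rV[R]_n) (z : 'rV[R]_(n + n)) : 'rV[R]_(n + n) :=
  row_mx (psi (lsubmx z)) ('D_(rsubmx z) psi (lsubmx z)).

Lemma ttransE c c' p : charts A c -> charts A c' -> cdom c p.1 -> cdom c' p.1 ->
  tlift_map (trans c c') (cmap (tc c) p) = cmap (tc c') p.
Proof.
move=> cA cA' cq cq'.
rewrite /tlift_map row_mxKl row_mxKr -(components_trans _ cA cA' cq cq').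
by rewrite {1}/trans /comp (cmapK cA cq).
Qed.

Lemma near_ttrans c c' p : charts A c -> charts A c' -> cdom c p.1 -> cdom c' p.1 ->
  \forall z \near cmap (tc c) p,
    tlift_map (trans c c') z = (cmap (tc c') \o cinv (tc c)) z.
Proof.
move=> cA cA' cq cq'; have := near_tchart cA cq (dom_open cA') cq'.
apply: filterS => _ [p' [h h' ->]]; rewrite (ttransE cA cA' h h').
exact: (congr1 (cmap (tc c')) (esym (tcmapK cA h))).
Qed.

Lemma tlift_map_smooth (psi : 'rV[R]_n -> 'rV[R]_n) z :
  smooth_at psi (lsubmx z) -> smooth_at (tlift_map psi) z.
Proof.
move=> sp; apply: smooth_at_row_mx.
  by apply: smooth_at_comp => //; apply: smooth_at_lsubmx; exact: smooth_at_id.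
apply: smooth_at_Ddir => //; first by apply: smooth_at_lsubmx; exact: smooth_at_id.
by apply: smooth_at_rsubmx; exact: smooth_at_id.
Qed.

Lemma derive_lsub (z v : 'rV[R]_(n + n)) :
  'D_v (fun y : 'rV[R]_(n + n) => lsubmx y) z = lsubmx v.
Proof. by rewrite derive_lsubmx ?derive_id //; have [] := is_diff_id z. Qed.

Lemma derive_rsub (z v : 'rV[R]_(n + n)) :
  'D_v (fun y : 'rV[R]_(n + n) => rsubmx y) z = rsubmx v.
Proof. by rewrite derive_rsubmx ?derive_id //; have [] := is_diff_id z. Qed.

Lemma smooth_lsub (z : 'rV[R]_(n + n)) : smooth_at (fun y : 'rV[R]_(n + n) => lsubmx y) z.
Proof. by apply: smooth_at_lsubmx; exact: smooth_at_id. Qed.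

Lemma smooth_rsub (z : 'rV[R]_(n + n)) : smooth_at (fun y : 'rV[R]_(n + n) => rsubmx y) z.
Proof. by apply: smooth_at_rsubmx; exact: smooth_at_id. Qed.

Lemma derive_tlift_map (psi : 'rV[R]_n -> 'rV[R]_n) (z v : 'rV[R]_(n + n)) :
  smooth_at psi (lsubmx z) ->
  'D_v (tlift_map psi) z = row_mx ('D_(lsubmx v) psi (lsubmx z))
    ('D_(rsubmx v) psi (lsubmx z) +
     'D_(lsubmx v) (fun y => 'D_(rsubmx z) psi y) (lsubmx z)).
Proof.
move=> sp; have sl := smooth_lsub z; have sr := smooth_rsub z.
have s1 : smooth_at (fun y => psi (lsubmx y)) z by exact: smooth_at_comp.
have s2 : smooth_at (fun y => 'D_(rsubmx y) psi (lsubmx y)) z by exact: smooth_at_Ddir.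
apply: etrans (derive_row_mx v s1 s2) _.
have e1 := derive_comp v (smooth_at_diff sl) (smooth_at_diff sp).
have e2 := derive_Ddir v sp sl sr.
rewrite (derive_lsub z v) in e1 e2; rewrite (derive_rsub z v) in e2.
exact: (congr2 row_mx e1 e2).
Qed.

Lemma tcomponentsE c p v : charts A c -> cdom c p.1 ->
  components TA (tc c) p v =
  'D_v (tlift_map (trans (chart_at A p.1) c)) (cmap (tc (chart_at A p.1)) p).
Proof.
move=> cA cq; apply/esym/near_eq_derive; apply: near_ttrans => //.
- exact: chart_atP.
- exact: chart_at_dom.
Qed.

Lemma trans0_smooth c p : charts A c -> cdom c p.1 ->
  smooth_at (trans (chart_at A p.1) c) (lsubmx (cmap (tc (chart_at A p.1)) p)).
Proof.
move=> cA cq; rewrite row_mxKl; apply: trans_smooth => //.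
- exact: chart_atP.
- exact: chart_at_dom.
Qed.

(** The fibre components change with a second derivative of the transition map, which disappears for
    vertical vectors. This correction is what the complete lift has to absorb. *)
Lemma tcomponents_row c p v : charts A c -> cdom c p.1 ->
  components TA (tc c) p v =
  row_mx (components A c p.1 (lsubmx v))
    (components A c p.1 (rsubmx v) +
     'D_(lsubmx v) (fun y => 'D_(p.2) (trans (chart_at A p.1) c) y)
       (cmap (chart_at A p.1) p.1)).
Proof.
move=> cA cq; rewrite (tcomponentsE v cA cq) (derive_tlift_map v (trans0_smooth cA cq)).
by rewrite !row_mxKl row_mxKr components_chart_at.
Qed.

Lemma tcomponents_chart_at p v : components TA (tc (chart_at A p.1)) p v = v.
Proof.
have cA := chart_atP p.1; have cq := chart_at_dom p.1.
rewrite -[RHS](derive_id (cmap (tc (chart_at A p.1)) p) v); apply: near_eq_derive.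
have := near_tchart cA cq (dom_open cA) cq.
by apply: filterS => _ [p' [h h' ->]]; exact: (congr1 (cmap (tc _)) (tcmapK cA h)).
Qed.

(** The chain rule through the transition map frees [vaction] from the preferred chart at [p]. *)
Lemma vaction_chart c p v (F : M * 'rV[R]_n -> R) : charts A c -> cdom c p.1 ->
  differentiable (F \o cinv (tc c)) (cmap (tc c) p) ->
  vaction TA p v F =
  'D_(components TA (tc c) p v) (F \o cinv (tc c)) (cmap (tc c) p).
Proof.
move=> cA cq dF; rewrite (tcomponentsE v cA cq).
set c0 := chart_at A p.1; set z0 := cmap (tc c0) p.
have c0A : charts A c0 := chart_atP p.1; have c0q : cdom c0 p.1 := chart_at_dom p.1.
have st : smooth_at (tlift_map (trans c0 c)) z0 by exact/tlift_map_smooth/trans0_smooth.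
have e0 : tlift_map (trans c0 c) z0 = cmap (tc c) p.
  exact: ttransE.
rewrite -e0 in dF *. rewrite -(derive_comp v (smooth_at_diff st) dF).
apply: near_eq_derive.
have := near_tchart c0A c0q (dom_open cA) cq.
apply: filterS => _ [p' [h h' ->]].
have e := esym (ttransE c0A cA h h').
transitivity (F p'); first exact: (congr1 F (tcmapK c0A h)).
apply: (congr1 F); apply: etrans (esym (tcmapK cA h')) _.
exact: (congr1 (cinv (tc c)) e).
Qed.

Lemma components_vlift c p (Z : M -> 'rV[R]_n) : charts A c -> cdom c p.1 ->
  components TA (tc c) p (vlift Z p) = row_mx 0 (components A c p.1 (Z p.1)).
Proof.
move=> cA cq; rewrite (tcomponents_row _ cA cq) /vlift row_mxKl row_mxKr.
by rewrite components0 derive0 addr0.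
Qed.

Lemma components_clift c p (Z : M -> 'rV[R]_n) : charts A c -> cdom c p.1 ->
  (forall c', charts A c' -> cdom c' p.1 -> smooth_at (local_field A c' Z) (cmap c' p.1)) ->
  components TA (tc c) p (clift A Z p) =
  row_mx (local_field A c Z (cmap c p.1))
    ('D_(components A c p.1 p.2) (local_field A c Z) (cmap c p.1)).
Proof.
case: p => q u /= cA cq sZ.
rewrite (tcomponents_row (p := (q, u)) _ cA cq) /clift row_mxKl row_mxKr /=.
rewrite local_field_cmap //; congr row_mx.
have c0A := chart_atP q; have c0q := chart_at_dom q.
set c0 := chart_at A q in c0A c0q *.
have st := trans_smooth c0A cA c0q cq.
have e : trans c0 c (cmap c0 q) = cmap c q by rewrite /trans /= cmapK.
have sZc := sZ c cA cq; rewrite -e in sZc.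
rewrite [components A c q u]componentsE -/c0 -e.
rewrite -(derive_comp u (smooth_at_diff st) (smooth_at_diff sZc)).
(* The transformation law of the components of [Z] holds near the point, so it can be differentiated
   along [u]. This yields D_u D_Z of the transition map where [tcomponents_row] has D_Z D_u, whence
   the call to [derive_comm]. *)
have -> : 'D_u (local_field A c Z \o trans c0 c) (cmap c0 q) =
    'D_u (fun y => 'D_(local_field A c0 Z y) (trans c0 c) y) (cmap c0 q).
  apply: near_eq_derive; have := near_chart c0A c0q (dom_open cA) cq.
  apply: filterS => _ [q' [h h' ->]].
  have e3 : (local_field A c Z \o trans c0 c) (cmap c0 q') = local_field A c Z (cmap c q').
    by rewrite /comp /trans /comp (cmapK c0A h).
  rewrite e3 (local_field_cmap Z cA h') (local_field_cmap Z c0A h).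
  exact: components_trans.
have e1 := derive_Ddir u (f := fun y => y) st (smooth_at_id _) (sZ c0 c0A c0q).
apply: esym; apply: etrans e1 _.
rewrite (derive_id (cmap c0 q) u) (local_field_cmap _ c0A c0q) components_chart_at.
have e2 := derive_comm u (Z q) st.
by rewrite e2.
Qed.

End Charts.

(** * The Lagrange equation in a chart *)

Section Lagrange.
Context {R : realType} {n : nat} {M : topologicalType} {A : atlas R n M}.
Context (hM : smooth_manifold A) (L : M * 'rV[R]_n -> R).
Context (hL : smooth_fun (tangent_atlas A) L).
Implicit Types (c : chart R n M) (q : M) (p : M * 'rV[R]_n).
Local Notation TA := (tangent_atlas A).
Local Notation tc := (tangent_chart A).

Definition local_fun c : 'rV[R]_(n + n) -> R := L \o cinv (tc c).

Lemma local_fun_smooth c p : charts A c -> cdom c p.1 ->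
  smooth_at (local_fun c) (cmap (tc c) p).
Proof.
move=> cA cq; have tcA : charts TA (tc c) by exists c.
apply: (smooth_on_at _ (hL tcA)); last by exists p.
rewrite openE => _ [p' cq' <-].
have := near_tchart hM cA cq' (dom_open hM cA) cq'.
by apply: filterS => _ [p'' [h h' ->]]; exists p''.
Qed.

Definition field_smooth (Z : M -> 'rV[R]_n) q : Prop :=
  forall c, charts A c -> cdom c q -> smooth_at (local_field A c Z) (cmap c q).

Definition vertical_der c (Z : M -> 'rV[R]_n) (z : 'rV[R]_(n + n)) : R :=
  'D_(row_mx 0 (local_field A c Z (lsubmx z))) (local_fun c) z.

Lemma vertical_der_smooth c Z z : smooth_at (local_fun c) z ->
  smooth_at (local_field A c Z) (lsubmx z) -> smooth_at (vertical_der c Z) z.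
Proof.
move=> sL sZ; apply: (@smooth_at_Ddir _ _ _ _ (local_fun c) (fun y => y)) => //.
  exact: smooth_at_id.
apply: smooth_at_row_mx; first exact: smooth_at_cst.
by apply: smooth_at_comp => //; exact: smooth_lsub.
Qed.

Lemma vaction_vlift c p Z : charts A c -> cdom c p.1 ->
  vaction TA p (vlift Z p) L = vertical_der c Z (cmap (tc c) p).
Proof.
move=> cA cq.
rewrite (vaction_chart hM _ cA cq (smooth_at_diff (local_fun_smooth cA cq))).
rewrite (components_vlift hM _ cA cq) /vertical_der row_mxKl.
by rewrite (local_field_cmap hM Z cA cq).
Qed.

Lemma cmap_lsub c p : lsubmx (cmap (tc c) p) = cmap c p.1.
Proof. by rewrite row_mxKl. Qed.

Lemma cmap_rsub c p : rsubmx (cmap (tc c) p) = components A c p.1 p.2.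
Proof. by rewrite row_mxKr. Qed.

(** The inner [vaction] uses the preferred chart of each [p']. It is first replaced, on a whole
    neighbourhood, by [vertical_der] in the single chart [c], and only then differentiated. *)
Lemma vaction_vaction_vlift c p Z v : charts A c -> cdom c p.1 ->
  field_smooth Z p.1 ->
  vaction TA p v (fun p' => vaction TA p' (vlift Z p') L) =
  'D_(components TA (tc c) p v) (vertical_der c Z) (cmap (tc c) p).
Proof.
move=> cA cq sZ.
have near_eq : \forall z \near cmap (tc c) p, vertical_der c Z z =
    ((fun p' => vaction TA p' (vlift Z p') L) \o cinv (tc c)) z.
  have := near_tchart hM cA cq (dom_open hM cA) cq.
  apply: filterS => _ [p' [h _ ->]]; rewrite -(vaction_vlift Z cA h).
  exact: (congr1 (fun p' => vaction TA p' (vlift Z p') L) (esym (tcmapK hM cA h))).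
have dE : differentiable (vertical_der c Z) (cmap (tc c) p).
  apply/smooth_at_diff/vertical_der_smooth; first exact: local_fun_smooth.
  by rewrite cmap_lsub; exact: sZ.
rewrite (vaction_chart hM v cA cq (near_eq_differentiable near_eq dE)).
exact/esym/near_eq_derive.
Qed.

Definition lagrange_form c (Z : M -> 'rV[R]_n) (z gam : 'rV[R]_(n + n)) : R :=
  'D_gam (vertical_der c Z) z -
  'D_(row_mx (local_field A c Z (lsubmx z))
        ('D_(rsubmx z) (local_field A c Z) (lsubmx z))) (local_fun c) z.

Lemma lagrange_chart c p G Z : charts A c -> cdom c p.1 -> field_smooth Z p.1 ->
  lagrange_eq A L G Z p <->
  lagrange_form c Z (cmap (tc c) p) (components TA (tc c) p (G p)) = 0.
Proof.
move=> cA cq sZ; rewrite /lagrange_eq /=.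
rewrite (vaction_vaction_vlift (G p) cA cq sZ).
rewrite (vaction_chart hM _ cA cq (smooth_at_diff (local_fun_smooth cA cq))).
by rewrite (components_clift hM cA cq sZ) /lagrange_form cmap_lsub cmap_rsub.
Qed.

(** The Euler-Lagrange expression contracted with a constant vector:
    [zeta^i (Gamma(dL/du^i) - dL/dq^i)]. *)
Definition euler_lagrange c (z gam : 'rV[R]_(n + n)) (zeta : 'rV[R]_n) : R :=
  'D_gam (fun y => 'D_(row_mx 0 zeta) (local_fun c) y) z -
  'D_(row_mx zeta 0) (local_fun c) z.

(* The terms of [Γ(Z^V L)] and [Z^C L] containing derivatives of [Z] cancel for
   a second-order [Γ]. *)
Lemma lagrange_formE c Z z gam : smooth_at (local_fun c) z ->
  smooth_at (local_field A c Z) (lsubmx z) -> lsubmx gam = rsubmx z ->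
  lagrange_form c Z z gam = euler_lagrange c z gam (local_field A c Z (lsubmx z)).
Proof.
move=> sL sZ so; rewrite /lagrange_form /euler_lagrange.
have sl := smooth_lsub z.
have sZl : smooth_at (fun y => local_field A c Z (lsubmx y)) z by exact: smooth_at_comp.
have s0 : smooth_at (fun _ : 'rV[R]_(n + n) => 0 : 'rV[R]_n) z by exact: smooth_at_cst.
have e1 := derive_Ddir gam (f := fun y => y) sL (smooth_at_id z)
  (smooth_at_row_mx s0 sZl).
have e2 := derive_row_mx gam s0 sZl.
have e3 := derive_comp gam (smooth_at_diff sl) (smooth_at_diff sZ).
rewrite derive_cst_fun in e2; rewrite (derive_lsub z gam) so in e3.
rewrite (derive_id z gam) in e1.
have e4 : 'D_gam (fun y : 'rV[R]_(n + n) => row_mx (0 : 'rV[R]_n) (local_field A c Z (lsubmx y))) z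
  = row_mx 0 ('D_(rsubmx z) (local_field A c Z) (lsubmx z)).
  exact: (etrans e2 (congr1 (row_mx 0) e3)).
rewrite e4 in e1.
have split_row (a b : 'rV[R]_n) : row_mx a b = row_mx 0 b + row_mx a 0.
  by rewrite add_row_mx add0r addr0.
have e5 a b : 'D_(row_mx a b) (local_fun c) z =
    'D_(row_mx 0 b) (local_fun c) z + 'D_(row_mx a 0) (local_fun c) z.
  apply: etrans (congr1 (fun v => 'D_v (local_fun c) z) (split_row a b)) _.
  exact: deriveDdir (smooth_at_diff sL).
have cancel (r s t : R) : (r + s) - (r + t) = s - t by ring.
exact: etrans (congr2 (fun s t => s - t) e1 (e5 _ _)) (cancel _ _ _).
Qed.

Lemma euler_lagrange_sum c z gam k (a : 'I_k -> R) (F : 'I_k -> 'rV[R]_n) :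
  smooth_at (local_fun c) z ->
  euler_lagrange c z gam (\sum_i a i *: F i) = \sum_i a i * euler_lagrange c z gam (F i).
Proof.
move=> sL; rewrite /euler_lagrange.
have row0l (G : 'I_k -> 'rV[R]_n) :
    row_mx 0 (\sum_i a i *: G i) = \sum_i a i *: row_mx (0 : 'rV[R]_n) (G i).
  by apply: (big_ind2 (fun x y => row_mx (0 : 'rV[R]_n) x = y)) => [|x1 x2 y1 y2 <- <-|i _];
    rewrite ?row_mx0 ?add_row_mx ?addr0 ?scale_row_mx ?scaler0.
have row0r (G : 'I_k -> 'rV[R]_n) :
    row_mx (\sum_i a i *: G i) 0 = \sum_i a i *: row_mx (G i) (0 : 'rV[R]_n).
  by apply: (big_ind2 (fun x y => row_mx x (0 : 'rV[R]_n) = y)) => [|x1 x2 y1 y2 <- <-|i _];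
    rewrite ?row_mx0 ?add_row_mx ?addr0 ?scale_row_mx ?scaler0.
have dLs y : differentiable (local_fun c) y -> forall w : 'I_k -> 'rV[R]_(n + n),
    'D_(\sum_i a i *: w i) (local_fun c) y = \sum_i a i * 'D_(w i) (local_fun c) y.
  move=> dL w; rewrite (derive_sumdir _ _ _ dL); apply: eq_bigr => i _.
  exact: deriveZdir.
rewrite row0l row0r (dLs z (smooth_at_diff sL)).
have sD i : smooth_at (fun y => a i *: 'D_(row_mx 0 (F i)) (local_fun c) y) z.
  apply: smooth_at_scale; first exact: smooth_at_cst.
  exact: smooth_at_derive.
have e1 : 'D_gam (fun y => 'D_(\sum_i a i *: row_mx 0 (F i)) (local_fun c) y) z =
    'D_gam (\sum_i (fun y => a i *: 'D_(row_mx 0 (F i)) (local_fun c) y)) z.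
  apply: near_eq_derive; apply: filterS (smooth_at_near sL) => y /smooth_at_diff dL.
  by apply: etrans (dLs y dL _) _; rewrite fct_sumE.
have e2 : 'D_gam (\sum_i (fun y => a i *: 'D_(row_mx 0 (F i)) (local_fun c) y)) z =
    \sum_i 'D_gam (fun y => a i *: 'D_(row_mx 0 (F i)) (local_fun c) y) z.
  by apply: derive_sum => i; exact/diff_derivable/smooth_at_diff.
have e3 i : 'D_gam (fun y => a i *: 'D_(row_mx 0 (F i)) (local_fun c) y) z =
    a i * 'D_gam (fun y => 'D_(row_mx 0 (F i)) (local_fun c) y) z.
  exact/deriveZ/diff_derivable/smooth_at_diff/smooth_at_derive.
apply: etrans (congr1 (fun t => t - _) (etrans e1 e2)) _.
rewrite -sumrB; apply: eq_bigr => i _; rewrite mulrBr.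
exact: (congr1 (fun t => t - _) (e3 i)).
Qed.

(** Both sides reduce to [euler_lagrange] on the common value. This exchanges a member of a local
    basis for a global field through the same vector. *)
Lemma lagrange_eq_value p (Z Z' : M -> 'rV[R]_n) G :
  lsubmx (G p) = p.2 -> field_smooth Z p.1 -> field_smooth Z' p.1 -> Z p.1 = Z' p.1 ->
  lagrange_eq A L G Z p -> lagrange_eq A L G Z' p.
Proof.
move=> so sZ sZ' eZ.
have cA := chart_atP hM p.1; have cq := chart_at_dom hM p.1.
have sL := local_fun_smooth cA cq.
move=> /(lagrange_chart _ cA cq sZ); rewrite (tcomponents_chart_at hM).
have so' : lsubmx (G p) = rsubmx (cmap (tc (chart_at A p.1)) p).
  by rewrite cmap_rsub (components_chart_at hM).
have sZc := sZ _ cA cq; have sZc' := sZ' _ cA cq.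
rewrite -(cmap_lsub _ p) in sZc sZc'.
move=> h; apply/(lagrange_chart _ cA cq sZ'); rewrite (tcomponents_chart_at hM).
rewrite (lagrange_formE sL sZc' so') -[RHS]h (lagrange_formE sL sZc so').
congr euler_lagrange.
by rewrite cmap_lsub (local_field_cmap hM _ cA cq) (local_field_cmap hM _ cA cq) eZ.
Qed.

(** Linearity of [euler_lagrange] in the value carries the equation from a basis to any section; the
    coefficients [a] are numbers attached to [p], not functions. *)
Lemma lagrange_eq_sum p (Z : M -> 'rV[R]_n) G k (a : 'I_k -> R) (X : 'I_k -> M -> 'rV[R]_n) :
  lsubmx (G p) = p.2 -> field_smooth Z p.1 -> (forall i, field_smooth (X i) p.1) ->
  Z p.1 = \sum_i a i *: X i p.1 ->
  (forall i, lagrange_eq A L G (X i) p) -> lagrange_eq A L G Z p.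
Proof.
move=> so sZ sX eZ h.
have cA := chart_atP hM p.1; have cq := chart_at_dom hM p.1.
have sL := local_fun_smooth cA cq.
have so' : lsubmx (G p) = rsubmx (cmap (tc (chart_at A p.1)) p).
  by rewrite cmap_rsub (components_chart_at hM).
have sc Y : field_smooth Y p.1 -> smooth_at (local_field A (chart_at A p.1) Y)
    (lsubmx (cmap (tc (chart_at A p.1)) p)).
  by move=> sY; rewrite cmap_lsub; exact: sY.
apply/(lagrange_chart _ cA cq sZ); rewrite (tcomponents_chart_at hM).
rewrite (lagrange_formE sL (sc _ sZ) so') cmap_lsub (local_field_cmap hM _ cA cq) eZ.
rewrite (components_chart_at hM) (euler_lagrange_sum _ _ _ sL).
apply: big1 => i _; have /(lagrange_chart _ cA cq (sX i)) := h i.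
rewrite (tcomponents_chart_at hM) (lagrange_formE sL (sc _ (sX i)) so').
by rewrite cmap_lsub (local_field_cmap hM _ cA cq) (components_chart_at hM) => ->; rewrite mulr0.
Qed.

End Lagrange.

(** * Local bases and vectors tangent to the constraint submanifold *)

Section LocalBasis.
Context {R : realType} {n m : nat} {M : topologicalType} {A : atlas R n M}.
Context (hM : smooth_manifold A) (D : M -> {vspace 'rV[R]_n}).
Implicit Types (c : chart R n M) (q : M) (p : M * 'rV[R]_n).
Local Notation TA := (tangent_atlas A).
Local Notation tc := (tangent_chart A).

Definition basis_mx (X : 'I_m -> M -> 'rV[R]_n) c (x : 'rV[R]_n) : 'M[R]_(m, n) :=
  \matrix_(a, j) local_field A c (X a) x 0 j.

Lemma mul_basis_mx X c x (k : 'rV[R]_m) :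
  k *m basis_mx X c x = \sum_a k 0 a *: local_field A c (X a) x.
Proof.
rewrite mulmx_sum_row; apply: eq_bigr => a _; congr (_ *: _).
by apply/rowP => j; rewrite !mxE.
Qed.

Section OneBasis.
Context (U : set M) (X : 'I_m -> M -> 'rV[R]_n) (hX : local_basis A D U X).

Lemma basis_field_smooth a q : U q -> field_smooth (A := A) (X a) q.
Proof.
move=> Uq c cA cq.
exact: (local_field_smooth hM (local_basis_smooth hX a) (local_basis_open hX)).
Qed.

Lemma basis_nth q (a : 'I_m) : [tuple X b q | b < m]`_a = X a q.
Proof. by rewrite -tnth_nth tnth_mktuple. Qed.

Lemma basis_coord q u : U q -> u \in D q ->
  exists k : 'rV[R]_m, u = \sum_a k 0 a *: X a q.
Proof.
move=> Uq uD; have hb := local_basisP hX Uq.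
exists (\row_a coord [tuple X b q | b < m] a u).
rewrite {1}(coord_basis hb uD); apply: eq_bigr => a _.
by rewrite mxE basis_nth.
Qed.

Lemma basis_mem q a : U q -> X a q \in D q.
Proof.
move=> Uq; have hb := local_basisP hX Uq.
by rewrite -(basis_nth q a); apply: (basis_mem hb); rewrite mem_nth // size_tuple.
Qed.

Lemma basis_span q (k : 'rV[R]_m) : U q -> \sum_a k 0 a *: X a q \in D q.
Proof. by move=> Uq; apply: memv_suml => a _; apply: memvZ; exact: basis_mem. Qed.

Lemma components_basis c q (k : 'rV[R]_m) : charts A c -> cdom c q ->
  components A c q (\sum_a k 0 a *: X a q) = k *m basis_mx X c (cmap c q).
Proof.
move=> cA cq; rewrite (components_sum hM _ _ _ _ cA cq) mul_basis_mx.
by apply: eq_bigr => a _; rewrite (local_field_cmap hM _ cA cq).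
Qed.

Lemma basis_mx_free c q : U q -> charts A c -> cdom c q ->
  row_free (basis_mx X c (cmap c q)).
Proof.
move=> Uq cA cq; apply: inj_row_free => k; rewrite -(components_basis k cA cq).
move=> /(components_eq0 hM cA cq) h0.
have /basis_free/freeP fr := local_basisP hX Uq.
apply/rowP => a; rewrite mxE; apply: (fr (fun a => k 0 a)) => //.
by rewrite -[RHS]h0; apply: eq_bigr => b _; rewrite basis_nth.
Qed.

Lemma basis_mx_smooth c q : U q -> charts A c -> cdom c q ->
  smooth_at (basis_mx X c) (cmap c q).
Proof.
move=> Uq cA cq; apply: smooth_at_mx => a j; under eq_fun do rewrite mxE.
by apply: smooth_at_coord; exact: basis_field_smooth.
Qed.

Lemma components_mem c p : U p.1 -> charts A c -> cdom c p.1 -> p.2 \in D p.1 ->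
  exists k : 'rV[R]_m,
    rsubmx (cmap (tc c) p) = k *m basis_mx X c (lsubmx (cmap (tc c) p)).
Proof.
move=> Uq cA cq /(basis_coord Uq)[k e]; exists k.
by rewrite cmap_lsub cmap_rsub e (components_basis _ cA cq).
Qed.

End OneBasis.

Context (X : 'I_m -> M -> 'rV[R]_n) (c : chart R n M) (N : 'M[R]_(n, m)).

(* Coordinates of [rsubmx z] on the basis at [lsubmx z]; [N] is any matrix for
   which [basis_mx *m N] is invertible, so that the formula makes sense, and is
   smooth, on a full neighbourhood in TM. *)
Definition basis_coef (z : 'rV[R]_(n + n)) : 'rV[R]_m :=
  rsubmx z *m N *m invmx (basis_mx X c (lsubmx z) *m N).

Lemma basis_coefE z k : basis_mx X c (lsubmx z) *m N \in unitmx ->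
  rsubmx z = k *m basis_mx X c (lsubmx z) -> basis_coef z = k.
Proof. by move=> u e; rewrite /basis_coef e -(mulmxA k) mulmxK. Qed.

Lemma basis_coefK z k : basis_mx X c (lsubmx z) *m N \in unitmx ->
  rsubmx z = k *m basis_mx X c (lsubmx z) ->
  rsubmx z = basis_coef z *m basis_mx X c (lsubmx z).
Proof. by move=> u e; rewrite (basis_coefE u e). Qed.

Lemma basis_lsub_smooth z : smooth_at (basis_mx X c) (lsubmx z) ->
  smooth_at (fun y : 'rV[R]_(n + n) => basis_mx X c (lsubmx y)) z.
Proof. by move=> sB; apply: smooth_at_comp => //; exact: smooth_lsub. Qed.

Lemma basis_coef_smooth z : smooth_at (basis_mx X c) (lsubmx z) ->
  basis_mx X c (lsubmx z) *m N \in unitmx -> smooth_at basis_coef z.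
Proof.
move=> sB u; have sN : smooth_at (fun=> N) z by exact: smooth_at_cst.
apply: smooth_at_mulmx.
  by apply: smooth_at_mulmx => //; exact: smooth_rsub.
apply: smooth_at_invmx => //; apply: smooth_at_mulmx => //.
exact: basis_lsub_smooth.
Qed.

(** The rate of change of y B(q) when q moves with velocity [rsubmx z] while the coordinates y on
    the basis stay constant. *)
Definition drift (z : 'rV[R]_(n + n)) : 'rV[R]_n :=
  basis_coef z *m 'D_(rsubmx z) (basis_mx X c) (lsubmx z).

Lemma drift_smooth z : smooth_at (basis_mx X c) (lsubmx z) ->
  basis_mx X c (lsubmx z) *m N \in unitmx -> smooth_at drift z.
Proof.
move=> sB u; apply: smooth_at_mulmx; first exact: basis_coef_smooth.
apply: smooth_at_Ddir => //; [exact: smooth_lsub|exact: smooth_rsub].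
Qed.

End LocalBasis.

Section Tangency.
Context {R : realType} {n m : nat} {M : topologicalType} {A : atlas R n M}.
Context (hM : smooth_manifold A) (D : M -> {vspace 'rV[R]_n}).
Context (U : set M) (X : 'I_m -> M -> 'rV[R]_n) (hX : local_basis A D U X).
Implicit Types (c : chart R n M) (q : M) (p : M * 'rV[R]_n).
Local Notation TA := (tangent_atlas A).
Local Notation tc := (tangent_chart A).

(** Along a curve in the constraint set the fibre part equals [basis_coef] times [basis_mx]
    identically. The product rule gives the two terms, with [f] the derivative of the basis
    coordinates along the curve. *)
Lemma tangent_to_components c p v N : U p.1 -> charts A c -> cdom c p.1 ->
  basis_mx (A := A) X c (lsubmx (cmap (tc c) p)) *m N \in unitmx ->
  tangent_to TA (constraint D) p v ->
  let z := cmap (tc c) p in let gam := components TA (tc c) p v in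
  exists f : 'rV[R]_m, rsubmx gam =
    basis_coef (A := A) X c N z *m 'D_(lsubmx gam) (basis_mx (A := A) X c) (lsubmx z) +
    f *m basis_mx (A := A) X c (lsubmx z).
Proof.
move=> Uq cA cq uN ht z gam; case: ht => e [g [e0 g0 hC sg Dg]].
set c0 := chart_at A p.1 in hC sg Dg.
have c0A : charts A c0 := chart_atP hM p.1.
have c0q : cdom c0 p.1 := chart_at_dom hM p.1.
pose crv (t : R) := cmap (tc c0) (g t).
have oe : open [set t : R | `|t| < e].
  have -> : [set t : R | `|t| < e] = ball (0 : R) e.
    by apply/seteqP; split=> t; rewrite -ball_normE /= sub0r normrN.
  exact: ball_open.
have Se : [set t : R | `|t| < e] 0 by rewrite /= normr0.
have scrv : smooth_at crv 0 by exact: (smooth_on_at oe sg Se).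
have crv0 : crv 0 = cmap (tc c0) p by rewrite /crv g0.
have st : smooth_at (tlift_map (trans c0 c)) (crv 0).
  by rewrite crv0; exact/tlift_map_smooth/(trans0_smooth hM cA cq).
(* The curve is given as smooth in the preferred chart; the tangent map of the transition carries it
   to [c]. *)
pose zet (t : R) := tlift_map (trans c0 c) (crv t).
have szet : smooth_at zet 0 by exact: smooth_at_comp.
have zet0 : zet 0 = z by rewrite /zet crv0; exact: (ttransE hM c0A cA c0q cq).
have Dzet : 'D_(1 : R) zet 0 = gam.
  apply: etrans (derive_comp (1 : R) (smooth_at_diff scrv) (smooth_at_diff st)) _.
  rewrite /gam (tcomponentsE hM v cA cq) -/c0 -crv0.
  by congr ('D__ _ _); exact: Dg.
have sB : smooth_at (basis_mx (A := A) X c) (lsubmx z).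
  by rewrite cmap_lsub; exact: (basis_mx_smooth hM hX).
have sl : smooth_at (fun t => lsubmx (zet t)) 0 by exact: smooth_at_lsubmx.
have sB0 : smooth_at (basis_mx (A := A) X c) (lsubmx (zet 0)) by rewrite zet0.
have sBz : smooth_at (fun t => basis_mx (A := A) X c (lsubmx (zet t))) 0.
  exact: (smooth_at_comp sl sB0).
have sC0 : smooth_at (basis_coef (A := A) X c N) (zet 0).
  by rewrite zet0; exact: (basis_coef_smooth sB uN).
have sC : smooth_at (fun t => basis_coef (A := A) X c N (zet t)) 0.
  exact: (smooth_at_comp szet sC0).
have nU : \forall t \near (0 : R),
    basis_mx (A := A) X c (lsubmx (zet t)) *m N \in unitmx.
  have sN : smooth_at (fun _ : R => N) 0 by exact: smooth_at_cst.
  apply: (near_unitmx (smooth_at_mulmx sBz sN)).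
  by rewrite zet0; exact: uN.
have nC : \forall t \near (0 : R), exists p', [/\ cdom c0 p'.1, (U `&` cdom c) p'.1 &
    crv t = cmap (tc c0) p'].
  apply: (near_preimage (P := fun z => exists p',
    [/\ cdom c0 p'.1, (U `&` cdom c) p'.1 & z = cmap (tc c0) p']) (smooth_at_cont scrv)).
  have oUc : open (U `&` cdom c).
    by apply: openI; [exact: local_basis_open hX|exact: (dom_open hM cA)].
  rewrite crv0; exact: (near_tchart hM c0A c0q oUc (conj Uq cq)).
have nE := near_openP oe Se.
have key : \forall t \near (0 : R), rsubmx (zet t) =
    basis_coef (A := A) X c N (zet t) *m basis_mx (A := A) X c (lsubmx (zet t)).
  near=> t.
  have [Ct c0t] : constraint D (g t) /\ cdom c0 (g t).1.
    by apply: hC; near: t; exact: nE.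
  have [p' [c0p' [Up' cp'] ep']] : exists p', [/\ cdom c0 p'.1, (U `&` cdom c) p'.1 &
    crv t = cmap (tc c0) p'] by near: t; exact: nC.
  (* Only the coordinates of [g] are known to be regular. Its base point is placed in [U] and in the
     domain of [c] by comparison with [p']: points of one chart with equal coordinates coincide. *)
  have eg : g t = p' by rewrite -(tcmapK hM c0A c0t) -(tcmapK hM c0A c0p') -ep'.
  have ez : zet t = cmap (tc c) p'.
    by rewrite /zet ep'; exact: (ttransE hM c0A cA c0p' cp').
  have ut : basis_mx (A := A) X c (lsubmx (zet t)) *m N \in unitmx by near: t; exact: nU.
  have D' : p'.2 \in D p'.1 by rewrite -eg.
  have [k ek] := components_mem hM hX Up' cA cp' D'.
  have ek' : rsubmx (zet t) = k *m basis_mx (A := A) X c (lsubmx (zet t)).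
    by rewrite ez; exact: ek.
  exact: (basis_coefK ut ek').
exists ('D_(1 : R) (fun t => basis_coef (A := A) X c N (zet t)) 0).
have e1 := derive_rsubmx (1 : R) (smooth_at_diff szet).
have e2 := derive_lsubmx (1 : R) (smooth_at_diff szet).
have e3 := derive_comp (1 : R) (smooth_at_diff sl) (smooth_at_diff sB0).
have e4 := derive_mulmx (1 : R) sC sBz.
rewrite Dzet in e1 e2; rewrite e2 in e3.
apply: etrans (esym e1) (etrans (near_eq_derive _ key) (etrans e4 _)).
have e5 := etrans e3 (congr1
  (fun y => 'D_(lsubmx gam) (basis_mx (A := A) X c) (lsubmx y)) zet0).
have e6 := congr1 (basis_coef (A := A) X c N) zet0.
have e7 := congr1 (fun y => basis_mx (A := A) X c (lsubmx y)) zet0.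
exact: (congr2 (fun a b => a + b) (congr2 mulmx e6 e5) (congr1 (mulmx _) e7)).
Unshelve. all: by end_near. Qed.

(** A witnessing curve: the base point runs along the straight line [x + t *: u] of the preferred
    chart and the basis coordinates along [k + t *: f]. *)
Lemma components_tangent_to p (k f : 'rV[R]_m) : U p.1 ->
  let c := chart_at A p.1 in let x := cmap c p.1 in
  p.2 = k *m basis_mx (A := A) X c x ->
  tangent_to TA (constraint D) p
    (row_mx p.2 (k *m 'D_(p.2) (basis_mx (A := A) X c) x + f *m basis_mx (A := A) X c x)).
Proof.
case: p => q u /= Uq eu.
set c := chart_at A q in eu *; set x := cmap c q in eu *.
have cA : charts A c := chart_atP hM q.
have cq : cdom c q := chart_at_dom hM q.
pose line (t : R) : 'rV[R]_n := x + t *: u.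
pose kk (t : R) : 'rV[R]_m := k + t *: f.
pose B := basis_mx (A := A) X c.
have s_id (t : R) : smooth_at (fun s : R => s) t by exact: smooth_at_id.
have saff j (a b : 'rV[R]_j) (t : R) : smooth_at (fun s : R => a + s *: b) t.
  apply: smooth_at_add; first exact: smooth_at_cst.
  by apply: smooth_at_scale => //; exact: smooth_at_cst.
have Daff j (a b : 'rV[R]_j) (t : R) : 'D_(1 : R) (fun s : R => a + s *: b) t = b.
  have [d e] := derive_scale (1 : R) (smooth_at_diff (s_id t)) (differentiable_cst b t).
  have [_ h] := is_deriveD (is_derive_cst a t (1 : R)) (derivableP (diff_derivable d)).
  apply: etrans h _; rewrite add0r; apply: etrans e _.
  by rewrite derive_id derive_cst_fun scaler0 add0r scale1r.
have line0 : line 0 = x by rewrite /line scale0r addr0.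
have kk0 : kk 0 = k by rewrite /kk scale0r addr0.
have nline : \forall t \near (0 : R), exists q', [/\ cdom c q', U q' & line t = cmap c q'].
  apply: (near_preimage (P := fun y => exists q', [/\ cdom c q', U q' & y = cmap c q'])
    (smooth_at_cont (saff _ x u 0))).
  by rewrite scale0r addr0; apply: (near_chart hM) => //; exact: local_basis_open hX.
have /nbhs_ballP[e /= e0 he] := nline.
have {}he (t : R) : `|t| < e -> exists q', [/\ cdom c q', U q' & line t = cmap c q'].
  by move=> te; apply: he; rewrite -ball_normE /= sub0r normrN.
(* Written as a combination of the [X a], so that membership in [D] is immediate; [h] below is the
   same curve in coordinates. *)
pose g (t : R) : M * 'rV[R]_n :=
  let q' := cinv c (line t) in (q', \sum_a kk t 0 a *: X a q').
pose h (t : R) := row_mx (line t) (kk t *m B (line t)).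
have gh (t : R) : `|t| < e -> [/\ constraint D (g t), cdom c (g t).1 & cmap (tc c) (g t) = h t].
  move=> /he[q' [cq' Uq' el]].
  have eq' : cinv c (line t) = q' by rewrite el (cmapK hM cA cq').
  split; rewrite /constraint /g /= eq' //; first exact: (basis_span hX).
  rewrite /h; congr (row_mx _ _); first by rewrite el.
  by apply: etrans (components_basis hM X (kk t) cA cq') _; rewrite -el.
have sh (t : R) : `|t| < e -> smooth_at h t.
  move=> /he[q' [cq' Uq' el]]; apply: smooth_at_row_mx; first exact: saff.
  apply: smooth_at_mulmx; first exact: saff.
  apply: (@smooth_at_comp _ _ _ _ line B); first exact: saff.
  by rewrite el; exact: (basis_mx_smooth hM hX).
have Dh : 'D_(1 : R) h 0 = row_mx u (k *m 'D_u B x + f *m B x).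
  have sB : smooth_at B (line 0) by rewrite line0; exact: (basis_mx_smooth hM hX).
  have sBl : smooth_at (fun t => B (line t)) 0.
    by apply: smooth_at_comp => //; exact: saff.
  have sk : smooth_at kk 0 by exact: saff.
  have sm : smooth_at (fun t => kk t *m B (line t)) 0 by exact: smooth_at_mulmx.
  have e1 := derive_row_mx (1 : R) (saff _ x u 0) sm.
  have e2 := derive_mulmx (1 : R) sk sBl.
  have e3 := derive_comp (1 : R) (smooth_at_diff (saff _ x u 0)) (smooth_at_diff sB).
  apply: etrans e1 _; apply: congr2; first exact: Daff.
  apply: etrans e2 _; rewrite kk0 line0.
  apply: congr2; last by apply: (congr1 (fun w => w *m B x)); exact: Daff.
  apply: (congr1 (mulmx k)); apply: etrans e3 _; rewrite Daff.
  by apply: (congr1 (fun y => 'D_u B y)).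
have S0 : `|0 : R| < e by rewrite normr0.
exists e, g; split; first exact: e0.
- have eq0 : cinv c (line 0) = q by rewrite line0 (cmapK hM cA cq).
  rewrite /g eq0 kk0; congr (_, _).
  by rewrite -(components_chart_at hM q (\sum_a _)) (components_basis hM X _ cA cq) -eu.
- by move=> t /gh[].
- apply: smooth_on_ext => t te; exists h; first exact: sh.
  by near=> s => /gh[].
apply: etrans Dh; apply: near_eq_derive.
have : \forall t \near (0 : R), `|t| < e by exact: nbhs0_lt.
by apply: filterS => t /gh[].
Unshelve. all: by end_near. Qed.

End Tangency.

(** * Existence and uniqueness *)

Section Extension.
Context {R : realType} {n m : nat} {M : topologicalType} {A : atlas R n M}.
Context (hM : smooth_manifold A) (D : M -> {vspace 'rV[R]_n}).
Context (U : set M) (X : 'I_m -> M -> 'rV[R]_n) (hX : local_basis A D U X).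

Lemma global_extension q a : U q -> exists Z : M -> 'rV[R]_n,
  [/\ smooth_vfield A setT Z, forall q', Z q' \in D q' & Z q = X a q].
Proof.
move=> Uq; set c := chart_at A q.
have cA : charts A c := chart_atP hM q.
have cq : cdom c q := chart_at_dom hM q.
have oU := local_basis_open hX.
have Sq : (cmap c @` (cdom c `&` U)) (cmap c q) by exists q.
have [h [K [sh h0 cK KS hK]]] := rV_bump (open_chart_img hM cA oU) Sq.
pose W : set M := cdom c `&` U.
have oW : open W by apply: openI => //; exact: (dom_open hM).
(* The quotient normalises the bump to 1 at [q]. *)
pose Z q' := if pselect (W q') then (h (cmap c q') / h (cmap c q)) *: X a q' else 0.
have KW : cinv c @` K `<=` W.
  by move=> _ [x /KS[q' [cq' Uq'] <-] <-]; rewrite (cmapK hM cA cq').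
(* Compact in a Hausdorff space: the image of [K] is closed in the whole manifold, so the extension
   by zero is smooth also at boundary points of [W]. *)
have closedK : closed (cinv c @` K).
  apply: (compact_closed (manifold_hausdorff hM)); apply: continuous_compact => //.
  apply: continuous_in_subspaceT => x /set_mem/KS[q' [cq' _] e].
  apply: (homeo_chart_inv_cont (manifold_charts hM cA)).
  by apply: mem_set; exists q'.
have Z0 q' : ~ (cinv c @` K) q' -> Z q' = 0.
  move=> nK; rewrite /Z; case: pselect => [[cq' Uq']|nW] /=; last by [].
  rewrite hK ?mul0r ?scale0r // => Kq'; apply: nK.
  by exists (cmap c q') => //; rewrite (cmapK hM cA cq').
exists Z; split.
- move=> c' c'A; apply: smooth_on_ext => _ [q1 [c'q1 _] <-].
  have [W1|nW1] := pselect (W q1); last first.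
    exists (fun=> 0); first exact: smooth_at_cst.
    have nK1 : (~` (cinv c @` K)) q1 by move=> /KW.
    have := near_chart hM c'A c'q1 (closed_openC closedK) nK1.
    apply: filterS => _ [q2 [c'q2 nK2 ->]] _.
    by rewrite (local_field_cmap hM _ c'A c'q2) Z0 // components0.
  exists (fun y => (h (trans c' c y) * (h (cmap c q))^-1) *: local_field A c' (X a) y).
    apply: smooth_at_scale; last exact: (basis_field_smooth hM hX a W1.2 c'A c'q1).
    apply: smooth_at_mul; last exact: smooth_at_cst.
    have st := trans_smooth hM c'A cA c'q1 W1.1.
    exact: (smooth_at_comp st (sh _)).
  have := near_chart hM c'A c'q1 oW W1.
  apply: filterS => _ [q2 [c'q2 W2 ->]] _.
  rewrite !(local_field_cmap hM _ c'A c'q2) /Z; case: pselect => [W2'|nW] /=; last by [].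
  by rewrite (componentsZ hM _ _ c'A c'q2) /trans /= (cmapK hM c'A c'q2).
- move=> q'; rewrite /Z; case: pselect => [[cq' Uq']|nW] /=; last exact: mem0v.
  by apply: memvZ; exact: (basis_mem hX).
by rewrite /Z; case: pselect => [Wq|[]//] /=; rewrite divff // scale1r.
Qed.

End Extension.

(** * The linear system at a point and its smooth dependence on the point *)

Section Solution.
Context {R : realType} {n m : nat} {M : topologicalType} {A : atlas R n M}.
Context (hM : smooth_manifold A) (D : M -> {vspace 'rV[R]_n}).
Context (L : M * 'rV[R]_n -> R) (hL : smooth_fun (tangent_atlas A) L).
Context (hreg : regular_lagrangian (m := m) A D L).
Context (U : set M) (X : 'I_m -> M -> 'rV[R]_n) (hX : local_basis A D U X).
Implicit Types (c : chart R n M) (q : M) (p : M * 'rV[R]_n).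
Local Notation TA := (tangent_atlas A).
Local Notation tc := (tangent_chart A).
Local Notation Bmx := (basis_mx (A := A) X).
Local Notation vder c b := (vertical_der (A := A) L c (X b)).
Local Notation lform c b := (lagrange_form (A := A) L c (X b)).

Definition hessian_mx c (z : 'rV[R]_(n + n)) : 'M[R]_m :=
  \matrix_(a, b) 'D_(row_mx 0 (local_field A c (X a) (lsubmx z))) (vder c b) z.

(** Right side of the system for [f]: minus the value of the equations on the second-order candidate
    with [f = 0], whose fibre part is [drift]. *)
Definition residual c N (z : 'rV[R]_(n + n)) : 'rV[R]_m :=
  \row_b - lform c b z (row_mx (rsubmx z) (drift (A := A) X c N z)).

Definition multiplier c N z : 'rV[R]_m := residual c N z *m invmx (hessian_mx c z).

Definition acceleration c N (z : 'rV[R]_(n + n)) : 'rV[R]_n :=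
  drift (A := A) X c N z + multiplier c N z *m Bmx c (lsubmx z).

Lemma field_smooth_lsub b c p : U p.1 -> charts A c -> cdom c p.1 ->
  smooth_at (local_field A c (X b)) (lsubmx (cmap (tc c) p)).
Proof. by move=> Up cA cq; rewrite cmap_lsub; exact: (basis_field_smooth hM hX). Qed.

Lemma basis_mx_smooth_lsub c p : U p.1 -> charts A c -> cdom c p.1 ->
  smooth_at (Bmx c) (lsubmx (cmap (tc c) p)).
Proof. by move=> Up cA cq; rewrite cmap_lsub; exact: (basis_mx_smooth hM hX). Qed.

Lemma vder_smooth b c p : U p.1 -> charts A c -> cdom c p.1 ->
  smooth_at (vder c b) (cmap (tc c) p).
Proof.
move=> Up cA cq.
exact: (vertical_der_smooth (local_fun_smooth hM hL cA cq) (field_smooth_lsub b Up cA cq)).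
Qed.

Lemma hessian_mx_unit c p : U p.1 -> charts A c -> cdom c p.1 -> constraint D p ->
  hessian_mx c (cmap (tc c) p) \in unitmx.
Proof.
move=> Up cA cq Cp; suff <- : \matrix_(a, b) vaction TA p (vlift (X a) p)
    (fun p' => vaction TA p' (vlift (X b) p') L) = hessian_mx c (cmap (tc c) p).
  exact: (hreg hX (conj Up Cp)).
apply/matrixP => a b; rewrite [LHS]mxE [RHS]mxE.
have sb : field_smooth (A := A) (X b) p.1 by exact: (basis_field_smooth hM hX).
apply: etrans (vaction_vaction_vlift hM hL (vlift (X a) p) cA cq sb) _.
apply: (congr1 (fun v => 'D_v (vder c b) (cmap (tc c) p))).
by rewrite (components_vlift hM _ cA cq) cmap_lsub (local_field_cmap hM _ cA cq).
Qed.

(** The equations are affine in [f] with linear part [hessian_mx], acting on row vectors from the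
    right. *)
Lemma lagrange_form_shift c b z w d (f : 'rV[R]_m) : differentiable (vder c b) z ->
  lform c b z (row_mx w (d + f *m Bmx c (lsubmx z))) =
  lform c b z (row_mx w d) + (f *m hessian_mx c z) 0 b.
Proof.
move=> dE; pose F a := local_field A c (X a) (lsubmx z).
have e1 : row_mx w (d + f *m Bmx c (lsubmx z)) =
    row_mx w d + \sum_a f 0 a *: row_mx (0 : 'rV[R]_n) (F a).
  rewrite mul_basis_mx -/F.
  have -> : \sum_a f 0 a *: row_mx (0 : 'rV[R]_n) (F a) = row_mx 0 (\sum_a f 0 a *: F a).
    by apply: (big_ind2 (fun x y => x = row_mx (0 : 'rV[R]_n) y))
      => [|x1 x2 y1 y2 -> ->|a _]; rewrite ?row_mx0 ?add_row_mx ?addr0 ?scale_row_mx ?scaler0.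
  by rewrite add_row_mx addr0.
have e2 : 'D_(row_mx w (d + f *m Bmx c (lsubmx z))) (vder c b) z =
    'D_(row_mx w d) (vder c b) z + (f *m hessian_mx c z) 0 b.
  apply: etrans (congr1 (fun v => 'D_v (vder c b) z) e1) _.
  apply: etrans (deriveDdir _ _ dE) _.
  apply: (congr1 (fun t => 'D_(row_mx w d) (vder c b) z + t)).
  apply: etrans (derive_sumdir _ _ _ dE) _.
  rewrite mxE; apply: eq_bigr => a _; rewrite mxE.
  exact: (deriveZdir (f 0 a) (row_mx 0 (F a)) dE).
have arith (r s t : R) : (r + s) - t = (r - t) + s by ring.
exact: etrans (congr1 (fun s => s - _) e2) (arith _ _ _).
Qed.

Lemma lagrange_form_multiplier c N p f : U p.1 -> charts A c -> cdom c p.1 ->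
  constraint D p -> let z := cmap (tc c) p in
  (forall b, lform c b z (row_mx (rsubmx z)
     (drift (A := A) X c N z + f *m Bmx c (lsubmx z))) = 0) <-> f = multiplier c N z.
Proof.
move=> Up cA cq Cp z; have u := hessian_mx_unit Up cA cq Cp; rewrite -/z in u.
have shift b := lagrange_form_shift (rsubmx z) (drift (A := A) X c N z) f
  (smooth_at_diff (vder_smooth b Up cA cq)).
split=> [h|-> b].
  rewrite /multiplier; have -> : residual c N z = f *m hessian_mx c z.
    apply/rowP => b; rewrite mxE; apply/eqP; rewrite eq_sym -subr_eq0 opprK addrC.
    by apply/eqP; apply: etrans (esym (shift b)) (h b).
  by rewrite mulmxK.
apply: etrans (lagrange_form_shift _ _ _ (smooth_at_diff (vder_smooth b Up cA cq))) _.
by rewrite /multiplier mulmxKV // [residual _ _ _ _ _]mxE addrN.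
Qed.

(** The whole problem at the single point [p]: [lagrange_eq] reads its field only at [p], so a
    constant function can stand for [v]. *)
Definition solution p (v : 'rV[R]_(n + n)) : Prop :=
  [/\ lsubmx v = p.2, tangent_to TA (constraint D) p v
    & forall a, lagrange_eq A L (fun=> v) (X a) p].

(** Taken in the preferred chart it gives uniqueness; taken with a fixed chart and a fixed [N] at
    all constraint points near a given one, it gives smoothness. *)
Lemma solution_components c N p v : U p.1 -> charts A c -> cdom c p.1 ->
  constraint D p -> Bmx c (lsubmx (cmap (tc c) p)) *m N \in unitmx -> solution p v ->
  components TA (tc c) p v =
  row_mx (rsubmx (cmap (tc c) p)) (acceleration c N (cmap (tc c) p)).
Proof.
move=> Up cA cq Cp uN [so ht hl]; set z := cmap (tc c) p in uN *.
have [f ef] := tangent_to_components hM hX Up cA cq uN ht.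
have el : lsubmx (components TA (tc c) p v) = rsubmx z.
  by rewrite (tcomponents_row hM v cA cq) row_mxKl so /z cmap_rsub.
have ev : components TA (tc c) p v = row_mx (rsubmx z)
    (drift (A := A) X c N z + f *m Bmx c (lsubmx z)).
  rewrite -[LHS]hsubmxK el; apply: (congr1 (row_mx (rsubmx z))).
  by apply: etrans ef _; rewrite el.
rewrite ev /acceleration.
suff -> : f = multiplier c N z by [].
apply/(lagrange_form_multiplier N f Up cA cq Cp) => b; rewrite -/z -ev.
have sb : field_smooth (A := A) (X b) p.1 by exact: (basis_field_smooth hM hX).
by have /(lagrange_chart hM hL _ cA cq sb) := hl b.
Qed.

(** [pinvmx] is a right inverse for full row rank, so the product is the identity matrix at this
    point. *)
Lemma basis_mx_inv c p : U p.1 -> charts A c -> cdom c p.1 ->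
  Bmx c (lsubmx (cmap (tc c) p)) *m pinvmx (Bmx c (cmap c p.1)) \in unitmx.
Proof.
move=> Up cA cq; rewrite cmap_lsub mulmxVp ?unitmx1 //.
exact: (basis_mx_free hM hX).
Qed.

Lemma solution_unique p v v' : U p.1 -> constraint D p ->
  solution p v -> solution p v' -> v = v'.
Proof.
move=> Up Cp sv sv'.
have cA := chart_atP hM p.1; have cq := chart_at_dom hM p.1.
have uN := basis_mx_inv Up cA cq.
rewrite -(tcomponents_chart_at hM p v) -(tcomponents_chart_at hM p v').
by rewrite (solution_components Up cA cq Cp uN sv) (solution_components Up cA cq Cp uN sv').
Qed.

Lemma solution_exists p : U p.1 -> constraint D p -> exists v, solution p v.
Proof.
move=> Up Cp; set c := chart_at A p.1.
have cA : charts A c := chart_atP hM p.1.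
have cq : cdom c p.1 := chart_at_dom hM p.1.
set z := cmap (tc c) p; set N := pinvmx (Bmx c (cmap c p.1)).
have uN : Bmx c (lsubmx z) *m N \in unitmx := basis_mx_inv Up cA cq.
have ez : rsubmx z = p.2 by rewrite /z cmap_rsub (components_chart_at hM).
have elz : lsubmx z = cmap c p.1 by rewrite /z cmap_lsub.
have [k ek] := components_mem hM hX Up cA cq Cp; rewrite -/z in ek.
have ek' := basis_coefK uN ek; rewrite ez elz in ek'.
(* Built in the preferred chart, where components are the vector itself and where [tangent_to] is
   tested. *)
exists (row_mx p.2 (acceleration c N z)); split.
- by rewrite row_mxKl.
- have := components_tangent_to hM hX (multiplier c N z) Up ek'.
  by rewrite /acceleration /drift ez elz.
move=> b; have sb : field_smooth (A := A) (X b) p.1 by exact: (basis_field_smooth hM hX).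
apply/(lagrange_chart hM hL _ cA cq sb).
rewrite (tcomponents_chart_at hM) -ez.
by have [_ /(_ erefl b)] := lagrange_form_multiplier N (multiplier c N z) Up cA cq Cp.
Qed.

Lemma acceleration_smooth c N p : U p.1 -> charts A c -> cdom c p.1 ->
  constraint D p -> Bmx c (lsubmx (cmap (tc c) p)) *m N \in unitmx ->
  smooth_at (acceleration c N) (cmap (tc c) p).
Proof.
move=> Up cA cq Cp uN; set z := cmap (tc c) p in uN *.
have sL : smooth_at (local_fun (A := A) L c) z := local_fun_smooth hM hL cA cq.
have sB : smooth_at (Bmx c) (lsubmx z) := basis_mx_smooth_lsub Up cA cq.
have sd := drift_smooth sB uN.
have sX b : smooth_at (local_field A c (X b)) (lsubmx z) := field_smooth_lsub b Up cA cq.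
have sl := smooth_lsub z; have sr := smooth_rsub z.
have sXl b : smooth_at (fun y => local_field A c (X b) (lsubmx y)) z.
  exact: (smooth_at_comp sl (sX b)).
have sE b : smooth_at (vder c b) z := vder_smooth b Up cA cq.
have sid : smooth_at (fun y => y) z := smooth_at_id z.
have s0 : smooth_at (fun _ : 'rV[R]_(n + n) => 0 : 'rV[R]_n) z by exact: smooth_at_cst.
have sres : smooth_at (residual c N) z.
  apply: smooth_at_mx => i b; rewrite /residual; under eq_fun do rewrite mxE.
  apply: smooth_at_opp; apply: smooth_at_add.
    exact: (smooth_at_Ddir (f := fun y => y) (sE b) sid (smooth_at_row_mx sr sd)).
  apply: smooth_at_opp.
  have sDX := smooth_at_Ddir (sX b) sl sr.
  exact: (smooth_at_Ddir (f := fun y => y) sL sid (smooth_at_row_mx (sXl b) sDX)).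
have shess : smooth_at (hessian_mx c) z.
  apply: smooth_at_mx => a b; rewrite /hessian_mx; under eq_fun do rewrite mxE.
  exact: (smooth_at_Ddir (f := fun y => y) (sE b) sid (smooth_at_row_mx s0 (sXl a))).
have u := hessian_mx_unit Up cA cq Cp.
apply: (smooth_at_add sd).
apply: (smooth_at_mulmx (smooth_at_mulmx sres (smooth_at_invmx shess u))).
exact: basis_lsub_smooth.
Qed.

End Solution.

(** In the preferred charts the projection is the first block of coordinates. This turns the
    second-order condition into [lsubmx v = p.2]. *)
Lemma dmap_fst (R : realType) (n : nat) (M : topologicalType) (A : atlas R n M)
    (p : M * 'rV[R]_n) (v : 'rV[R]_(n + n)) : smooth_manifold A ->
  dmap (tangent_atlas A) A fst p v = lsubmx v.
Proof.
move=> hM; have cA := chart_atP hM p.1; have cq := chart_at_dom hM p.1.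
apply: etrans (derive_lsub (cmap (tangent_chart A (chart_at A p.1)) p) v).
apply: near_eq_derive; have := near_tchart hM cA cq (dom_open hM cA) cq.
apply: filterS => _ [p' [h _ ->]]; rewrite cmap_lsub.
exact: (congr1 (fun r => cmap (chart_at A p.1) r.1) (tcmapK hM cA h)).
Qed.

Theorem proposition2 (R : realType) (n m : nat) (Q : topologicalType)
    (A : atlas R n Q) (D : Q -> {vspace 'rV[R]_n}) (L : Q * 'rV[R]_n -> R)
    (hQ : smooth_manifold A)
    (hD : nonholonomic (m := m) A D)
    (hL : smooth_fun (tangent_atlas A) L)
    (hreg : regular_lagrangian (m := m) A D L) :
  exists G : Q * 'rV[R]_n -> 'rV[R]_(n + n),
    [/\ constrained_sode A D setT G /\
          (forall Z : Q -> 'rV[R]_n, smooth_vfield A setT Z ->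
             (forall q, Z q \in D q) ->
             forall p, constraint D p -> lagrange_eq A L G Z p),
        (forall G' : Q * 'rV[R]_n -> 'rV[R]_(n + n),
           constrained_sode A D setT G' ->
           (forall Z : Q -> 'rV[R]_n, smooth_vfield A setT Z ->
              (forall q, Z q \in D q) ->
              forall p, constraint D p -> lagrange_eq A L G' Z p) ->
           forall p, constraint D p -> G' p = G p)
      & (forall (U : set Q) (X : 'I_m -> Q -> 'rV[R]_n),
           local_basis A D U X ->
           (forall a p, constraint_over D U p -> lagrange_eq A L G (X a) p) /\
           (forall G' : Q * 'rV[R]_n -> 'rV[R]_(n + n),
              constrained_sode A D U G' ->
              (forall a p, constraint_over D U p -> lagrange_eq A L G' (X a) p) ->
              forall p, constraint_over D U p -> G' p = G p))].
Proof.
(* The value is made total, 0 off the constraint set, so that [choice] applies; the basis may differ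
   from point to point. *)
have ex p : exists v, constraint D p -> exists U (X : 'I_m -> Q -> 'rV[R]_n),
    [/\ local_basis A D U X, U p.1 & solution (A := A) D L X p v].
  have [Cp|nC] := pselect (constraint D p); last by exists 0.
  have [U [X [Up hX]]] := nonholonomic_smooth hD p.1.
  have [v sv] := solution_exists hQ hL hreg hX Up Cp.
  by exists v => _; exists U, X; exact: And3 hX Up sv.
have [G hG] := choice ex; exists G.
have soG p : constraint D p -> lsubmx (G p) = p.2 by move=> /hG[U [X [_ _ []]]].
have tgG p : constraint D p -> tangent_to (tangent_atlas A) (constraint D) p (G p).
  by move=> /hG[U [X [_ _ []]]].
have lagG (Z : Q -> 'rV[R]_n) p : constraint D p -> field_smooth (A := A) Z p.1 ->
    Z p.1 \in D p.1 -> lagrange_eq A L G Z p.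
  move=> Cp sZ ZD; have [U [X [hX Up [so _ hl]]]] := hG p Cp.
  have [k ek] := basis_coord hX Up ZD.
  have sX i : field_smooth (A := A) (X i) p.1 by exact: (basis_field_smooth hQ hX).
  exact: (lagrange_eq_sum hQ hL so sZ sX ek hl).
(* Although [G p] was obtained from one basis, it satisfies the equation for every section, hence
   for every local basis around [p]. *)
have solG (U : set Q) (X : 'I_m -> Q -> 'rV[R]_n) p : local_basis A D U X -> U p.1 ->
    constraint D p -> solution (A := A) D L X p (G p).
  move=> hX Up Cp; split; [exact: soG|exact: tgG|] => a.
  have sX : field_smooth (A := A) (X a) p.1 by exact: (basis_field_smooth hQ hX).
  exact: (lagG (X a) p Cp sX (basis_mem hX a Up)).
have uniqG (U : set Q) (X : 'I_m -> Q -> 'rV[R]_n) p v : local_basis A D U X -> U p.1 ->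
    constraint D p -> lsubmx v = p.2 ->
    tangent_to (tangent_atlas A) (constraint D) p v ->
    (forall a, lagrange_eq A L (fun=> v) (X a) p) -> v = G p.
  move=> hX Up Cp so tg hl.
  have sv : solution (A := A) D L X p v by split.
  exact: (solution_unique hQ hL hreg hX Up Cp sv (solG U X p hX Up Cp)).
have globS (Z : Q -> 'rV[R]_n) q : smooth_vfield A setT Z -> field_smooth (A := A) Z q.
  move=> sZ c cA cq; exact: (local_field_smooth hQ sZ openT).
split.
- split; last by move=> Z sZ ZD p Cp; apply: lagG => //; exact: globS.
  split=> [_ [c cA <-]|p [_ Cp]|p [_ Cp]]; last exact: tgG.
    apply: smooth_on_ext => _ [p0 [cq0 [_ Cp0]] <-].
    have [U [X [Up0 hX]]] := nonholonomic_smooth hD p0.1.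
    (* Computed at [p0] and then frozen, so that the formula depends smoothly on [z]. *)
    set N := pinvmx (basis_mx (A := A) X c (cmap c p0.1)).
    have uN := basis_mx_inv hQ hX Up0 cA cq0; rewrite -/N in uN.
    exists (fun z => row_mx (rsubmx z) (acceleration (A := A) L X c N z)).
      apply: smooth_at_row_mx; first exact: smooth_rsub.
      exact: (acceleration_smooth hQ hL hreg hX).
    have sB := basis_lsub_smooth (basis_mx_smooth_lsub hQ hX Up0 cA cq0).
    have sN : smooth_at (fun=> N) (cmap (tangent_chart A c) p0) by exact: smooth_at_cst.
    have nU := near_unitmx (smooth_at_mulmx sB sN) uN.
    have nC := near_tchart hQ cA cq0 (local_basis_open hX) Up0.
    (* At each constraint point near [p0], uniqueness identifies the chosen [G p] with this one
       formula. *)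
    apply: filterS2 nU nC => z uz [p1 [cq1 Up1 e1]] [p [cq [_ Cp]] e].
    have ep : p1 = p by rewrite -(tcmapK hQ cA cq1) -e1 -e; exact: (tcmapK hQ cA cq).
    rewrite ep in Up1; rewrite -e in uz *.
    have -> : local_field (tangent_atlas A) (tangent_chart A c) G (cmap (tangent_chart A c) p) =
        components (tangent_atlas A) (tangent_chart A c) p (G p).
      exact: (congr1 (fun r => components (tangent_atlas A) (tangent_chart A c) r (G r))
        (tcmapK hQ cA cq)).
    exact: (solution_components hQ hL hreg hX Up1 cA cq Cp uz (solG U X p hX Up1 Cp)).
  by rewrite (dmap_fst _ _ hQ) soG.
- move=> G' sG' hl p Cp; have [U [X [Up hX]]] := nonholonomic_smooth hD p.1.
  have Cp' : constraint_over D setT p by split.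
  have so : lsubmx (G' p) = p.2.
    by have := sode_second_order sG' Cp'; rewrite (dmap_fst _ _ hQ).
  apply: (uniqG U X p) => // [|a]; first exact: (sode_tangent sG' Cp').
  have [Z [sZ ZD eZ]] := global_extension hQ hX a Up.
  have sX : field_smooth (A := A) (X a) p.1 by exact: (basis_field_smooth hQ hX).
  exact: (lagrange_eq_value hQ hL so (globS Z p.1 sZ) sX eZ (hl Z sZ ZD p Cp)).
move=> U X hX; split=> [a p [Up Cp]|G' sG' hl p [Up Cp]].
  by have [_ _] := solG U X p hX Up Cp; apply.
have so : lsubmx (G' p) = p.2.
  by have := sode_second_order sG' (conj Up Cp); rewrite (dmap_fst _ _ hQ).
apply: (uniqG U X p) => // [|a]; first exact: (sode_tangent sG' (conj Up Cp)).
exact: (hl a p (conj Up Cp)).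
Qed.
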